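(* Let $k_R,k_\gamma>0$ and consider the attitude and bias observer $$\dot{\bar R}=\bar R\,[\Omega_z-\bar\gamma-k_Re_R]^{\wedge},\qquad \dot{\bar\gamma}=k_\gamma e_R ,$$ with $(\bar R(t),\bar\gamma(t))\in \mathrm{SO}(3)\times\mathbb{R}^3$, for the attitude kinematics $\dot R=R\hat\Omega$ with gyro measurement $\Omega_z=\Omega+\gamma$ and (possibly time-varying) reference directions $s_1(t),\dots,s_n(t)$, under the setting and standing assumptions given in the context. Suppose $k_R>2d/c_1^2$. Then $(\bar R,\bar\gamma)=(R,\gamma)$ is locally exponentially stable. More specifically, for $a\in(0,\tfrac12)$, choose a constant $\mu>0$ satisfying $$\mu<\min\left\{\sqrt{\frac{c_1}{4k_\gamma}},\ \frac{(1-a)c_1^2k_R-d}{2c_2k_\gamma},\ \frac{\frac12(1-2a)\{(1-a)c_1^2k_R-d\}}{\left(c_2k_R+\frac{B_\Omega}{2}\right)^2+c_2k_\gamma(1-2a)}\right\}.$$ Define the matrices $M_1,M_2,M_3\in\mathbb{R}^{2\times2}$ by $$M_1=\begin{bmatrix}\frac14c_1&-\frac{\sqrt2}{2}\mu\\-\frac{\sqrt2}{2}\mu&\frac1{2k_\gamma}\end{bmatrix},\qquad M_2=\begin{bmatrix}\frac14c_2&\frac{\sqrt2}{2}\mu\\\frac{\sqrt2}{2}\mu&\frac1{2k_\gamma}\end{bmatrix},$$ $$M_3=\begin{bmatrix}\frac12\{(1-a)c_1^2k_R-d\}-\mu c_2k_\gamma&-\mu\sqrt2\left(c_2k_R+\frac{B_\Omega}{2}\right)\\-\mu\sqrt2\left(c_2k_R+\frac{B_\Omega}{2}\right)&2\mu(1-2a)\end{bmatrix},$$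 and let $$\beta=\sqrt{\frac{\lambda_{\max}(M_2)}{\lambda_{\min}(M_1)}},\qquad \sigma=\frac{\lambda_{\min}(M_3)}{\lambda_{\max}(M_2)}.$$ Then, for every trajectory starting from an initial condition satisfying $$\Psi(\bar R(0),0)+\frac1{2k_\gamma}\|e_\gamma(0)\|^2\le 2ac_1,$$ the estimation error converges exponentially in the sense that, for all $t\ge0$, $$\|z(t)\|\le\beta\,\|z(0)\|\,e^{-\frac{\sigma}{2}t},\qquad\text{where } z=(\|E_R\|,\|e_\gamma\|)\in\mathbb{R}^2 .$$
   Context: Notation. $\mathrm{SO}(3)=\{R\in\mathbb{R}^{3\times3}: R^TR=I_{3\times 3},\ \det R=1\}$ and $\mathsf{S}^2=\{q\in\mathbb{R}^3:\|q\|=1\}$. For $x\in\mathbb{R}^3$, $\hat x=x^\wedge$ is the skew-symmetric $3\times3$ matrix with $\hat xy=x\times y$ for all $y\in\mathbb{R}^3$; $\vee$ is the inverse of the hat map, from skew-symmetric matrices to $\mathbb{R}^3$. For matrices or vectors of the same size $\langle A,B\rangle=\operatorname{tr}(A^TB)$ and $\|A\|^2=\langle A,A\rangle$ (Frobenius/Euclidean norm). $\lambda_{\min},\lambda_{\max}$ denote the minimum and maximum eigenvalues of a symmetric matrix. True system. $R(t)\in\mathrm{SO}(3)$ satisfies $\dot R=R\hat\Omega$, with angular velocity $\Omega(t)\in\mathbb{R}^3$. The measured angular velocity is $\Omega_z=\Omega+\gamma$ with a fixed bias $\gamma\in\mathbb{R}^3$. There are known reference directions $s_1(t),\dots,s_n(t)\in\mathsf{S}^2$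 in the inertial frame, and measurements $b_i=R^Ts_i\in\mathsf{S}^2$ in the body-fixed frame. For positive weights $w_1,\dots,w_n$, set $G(t)=\sum_{i=1}^nw_is_i(t)s_i(t)^T$. Standing assumptions. There are positive constants $B_\Omega,c,d$ such that for all $t\ge0$: (1) $\|\Omega(t)\|\le B_\Omega$; (2) $c\le\lambda_2(G(t))$, where $\lambda_2(G(t))$ is the second largest eigenvalue of $G(t)$; (3) $\|\dot G(t)\|\le d$. Errors. $\bar R(t)\in\mathrm{SO}(3)$ and $\bar\gamma(t)\in\mathbb{R}^3$ are the estimates of $R$ and $\gamma$. Put $E_R=R-\bar R$, $e_\gamma=\gamma-\bar\gamma$, $$\Psi(\bar R,t)=\tfrac12\langle G(t)E_R,E_R\rangle,\qquad e_R=(R^TG\bar R-\bar R^TGR)^\vee=\sum_{i=1}^nw_i\,\bar R^Ts_i\times b_i .$$ The constants $0<c_1\le c_2$ are positive constants such that $\frac14c_1\|E_R\|^2\le\Psi(\bar R,t)\le\frac14c_2\|E_R\|^2$ for all $\bar R\in\mathrm{SO}(3)$ and all $t\ge0$ (such constants exist under the assumptions above). Local exponential stability of $(\bar R,\bar\gamma)=(R,\gamma)$ means local exponential stability of the zero estimation error $z=(\|E_R\|,\|e_\gamma\|)=0$: there are constants $\delta,\beta',\sigma'>0$ such that $\|z(0)\|<\delta$ implies $\|z(t)\|\le\beta'\|z(0)\|e^{-\sigma't}$ for all $t\ge0$. *)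

(* Defs.v *)
From HB Require Import structures.
From mathcomp Require Import all_boot all_order all_algebra.
From mathcomp Require Import complex.
From mathcomp Require Import all_classical all_reals all_analysis.
From mathcomp Require Import ring.

Set Implicit Arguments.
Unset Strict Implicit.
Unset Printing Implicit Defensive.

Import Order.TTheory GRing.Theory Num.Theory.
Import numFieldNormedType.Exports.

Local Open Scope classical_set_scope.
Local Open Scope ring_scope.

Definition mx_of_rows (R : realType) (m n : nat) (l : seq (seq R)) : 'M[R]_(m, n) :=
  \matrix_(i < m, j < n) (nth [::] l i)`_j.

Definition vec2 (R : realType) (a b : R) : 'cV[R]_2 :=
  mx_of_rows 2 1 [:: [:: a]; [:: b]].

Definition vec3 (R : realType) (a b c : R) : 'cV[R]_3 :=
  mx_of_rows 3 1 [:: [:: a]; [:: b]; [:: c]].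

(* The norm that the library puts on matrices is the max norm; it is used below
   only for its topology, all estimates being in the Frobenius norm. *)
Definition inner (R : realType) (m n : nat) (A B : 'M[R]_(m, n)) : R :=
  \tr (A^T *m B).

Definition fnorm (R : realType) (m n : nat) (A : 'M[R]_(m, n)) : R :=
  Num.sqrt (inner A A).

Definition SO3 (R : realType) : set 'M[R]_3 :=
  [set Q | Q^T *m Q = 1%:M /\ \det Q = 1].

Definition sphere2 (R : realType) : set 'cV[R]_3 := [set q | fnorm q = 1].

Definition cross (R : realType) (x y : 'cV[R]_3) : 'cV[R]_3 :=
  vec3 (x 1 0 * y 2 0 - x 2 0 * y 1 0)
       (x 2 0 * y 0 0 - x 0 0 * y 2 0)
       (x 0 0 * y 1 0 - x 1 0 * y 0 0).

Definition hat (R : realType) (x : 'cV[R]_3) : 'M[R]_3 :=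
  mx_of_rows 3 3 [:: [:: 0; - x 2 0; x 1 0];
                     [:: x 2 0; 0; - x 0 0];
                     [:: - x 1 0; x 0 0; 0]].

(* Total on 'M_3, but meaningful on skew-symmetric matrices only, where it
   inverts hat (veeK, hatK). *)
Definition vee (R : realType) (A : 'M[R]_3) : 'cV[R]_3 :=
  vec3 (A 2 1) (A 0 2) (A 1 0).

Lemma mulmx_hat (R : realType) (x y : 'cV[R]_3) : hat x *m y = cross x y.
Proof.
apply/matrixP => i j; rewrite ord1 !mxE.
rewrite !big_ord_recl big_ord0 !mxE.
have e1 : lift ord0 ord0 = 1 :> 'I_3 by exact: val_inj.
have e2 : lift ord0 (lift ord0 ord0) = 2 :> 'I_3 by exact: val_inj.
case: i => -[|[|[|//]]] i3 /=; rewrite ?e1 ?e2; ring.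
Qed.

Lemma hatK (R : realType) : cancel (@hat R) (@vee R).
Proof.
move=> x; apply/matrixP => i j; rewrite ord1 !mxE.
by case: i => -[|[|[|//]]] i3; rewrite /= ?mxE /=; congr (x _ _); exact: val_inj.
Qed.

Lemma veeK (R : realType) (A : 'M[R]_3) : A^T = - A -> hat (vee A) = A.
Proof.
move=> As; have E i j : - A j i = A i j.
  by have /matrixP/(_ j i) := As; rewrite !mxE => ->.
have D i : 0 = A i i.
  by apply/esym/eqP; rewrite -[_ == 0](mulrn_eq0 _ 2) mulr2n -{1}E addNr.
have o (k : 'I_3) : [\/ k = 0, k = 1 | k = 2].
  by case: k => -[|[|[|//]]] k3; [constructor 1|constructor 2|constructor 3];
    exact: val_inj.
apply/matrixP => i j; rewrite !mxE.
by case: (o i) => ->; case: (o j) => -> /=; rewrite ?mxE /= ?E.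
Qed.

Lemma hat_cross (R : realType) (x y : 'cV[R]_3) : hat (cross x y) = y *m x^T - x *m y^T.
Proof.
apply/matrixP => i j; rewrite !mxE !big_ord_recl !big_ord0 !mxE.
have o (k : 'I_3) : [\/ k = 0, k = 1 | k = 2].
  by case: k => -[|[|[|//]]] k3; [constructor 1|constructor 2|constructor 3];
    exact: val_inj.
by case: (o i) => ->; case: (o j) => -> /=; rewrite ?mxE /=; ring.
Qed.

(* The eigenvalues of A in decreasing order, with multiplicity.  The default
   [::] is never used for symmetric A (eigvalsP). *)
Definition eigvals (R : realType) (n : nat) (A : 'M[R]_n) : seq R :=
  xget [::] [set l | sorted >=%R l /\ char_poly A = \prod_(x <- l) ('X - x%:P)].

Definition lambda_max (R : realType) (n : nat) (A : 'M[R]_n) : R :=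
  head 0 (eigvals A).

Definition lambda_min (R : realType) (n : nat) (A : 'M[R]_n) : R :=
  last 0 (eigvals A).

Definition lambda_2 (R : realType) (n : nat) (A : 'M[R]_n) : R :=
  (eigvals A)`_1.

Lemma char_poly_similar (F : fieldType) (n : nat) (P D : 'M[F]_n) :
  P \in unitmx -> char_poly (invmx P *m D *m P) = char_poly D.
Proof.
move=> Pu; rewrite /char_poly /char_poly_mx.
have -> : 'X%:M - map_mx polyC (invmx P *m D *m P) =
    map_mx polyC (invmx P) *m ('X%:M - map_mx polyC D) *m map_mx polyC P.
  rewrite mulmxBr mulmxBl !map_mxM; congr (_ - _).
  by rewrite scalar_mxC -mulmxA -map_mxM mulVmx// map_mx1 mulmx1.
rewrite !det_mulmx mulrAC -det_mulmx -map_mxM mulVmx//.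
by rewrite map_mx1 det1 mul1r.
Qed.

Lemma eigvals_exists (R : realType) (n : nat) (A : 'M[R]_n) : A^T = A ->
  exists l : seq R,
    sorted >=%R l /\ char_poly A = \prod_(x <- l) ('X - x%:P).
Proof.
move=> As; pose toC := complex.real_complex R.
pose B : 'M[complex.complex R]_n := map_mx toC A.
have Bh : B \is hermsymmx.
  apply: realsym_hermsym.
    by apply/is_hermitianmxP; rewrite expr0 scale1r map_mx_id// map_trmx As.
  by apply/mxOverP => i j; rewrite mxE; apply/complex.complex_realP; exists (A i j).
have /hermitian_normalmx/orthomx_spectralP BE := Bh.
have /mxOverP Dr := hermitian_spectral_diag_real Bh.
pose l := [seq complex.Re (spectral_diag B 0 i) | i : 'I_n].
have lE : map_poly toC (\prod_(x <- l) ('X - x%:P)) = char_poly B.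
  have -> : char_poly B = char_poly (diag_mx (spectral_diag B)).
    by rewrite {1}BE char_poly_similar ?spectral_unit.
  rewrite char_poly_trig ?diag_mx_is_trig// rmorph_prod /= big_map big_enum /=.
  apply: eq_bigr => i _; rewrite rmorphB /= map_polyX map_polyC /= !mxE eqxx.
  by rewrite complex.RRe_real.
exists (sort >=%R l); split.
  by apply: sort_sorted => x y; rewrite orbC le_total.
apply: (map_poly_inj toC); rewrite map_char_poly -/B -lE; congr map_poly.
by apply: perm_big; rewrite perm_sym perm_sort.
Qed.

Lemma eigvalsP (R : realType) (n : nat) (A : 'M[R]_n) : A^T = A ->
  sorted >=%R (eigvals A) /\ char_poly A = \prod_(x <- eigvals A) ('X - x%:P).
Proof. by move=> /eigvals_exists lP; exact: (xgetPex [::] lP). Qed.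

(* d/dt f(t) = v for a function of time t >= 0: two-sided for t > 0, and
   one-sided at t = 0. *)
Definition has_time_deriv (R : realType) (V : normedModType R)
    (f : R -> V) (t : R) (v : V) : Prop :=
  h^-1 *: (f (t + h) - f t) @[h --> within [set h | 0 <= t + h] 0^'] --> v.

Definition attitude_kinematics (R : realType)
    (Rt : R -> 'M[R]_3) (Omega : R -> 'cV[R]_3) : Prop :=
  forall t, 0 <= t ->
    SO3 (Rt t) /\ has_time_deriv Rt t (Rt t *m hat (Omega t)).

Definition Gmx (R : realType) (n : nat) (w : 'I_n -> R)
    (s : 'I_n -> R -> 'cV[R]_3) (t : R) : 'M[R]_3 :=
  \sum_(i < n) w i *: (s i t *m (s i t)^T).

Definition Psi (R : realType) (G Q Qbar : 'M[R]_3) : R :=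
  2^-1 * inner (G *m (Q - Qbar)) (Q - Qbar).

Definition err_R (R : realType) (G Q Qbar : 'M[R]_3) : 'cV[R]_3 :=
  vee (Q^T *m G *m Qbar - Qbar^T *m G *m Q).

(* err_R is computable from the measurements b_i = Q^T s_i. *)
Lemma err_R_measured (R : realType) (n : nat) (w : 'I_n -> R)
    (s : 'I_n -> R -> 'cV[R]_3) (t : R) (Q Qbar : 'M[R]_3) :
  err_R (Gmx w s t) Q Qbar =
  \sum_(i < n) w i *: cross (Qbar^T *m s i t) (Q^T *m s i t).
Proof.
rewrite /err_R; set S := \sum_(_ < _) _; rewrite -[RHS]hatK; congr vee.
have hatD : {morph @hat R : x y / x + y}.
  move=> x y; apply/matrixP => -[[|[|[|//]]] i3] [[|[|[|//]]] j3];
    rewrite !mxE /= ?mxE; ring.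
have hatZ k x : hat (k *: x) = k *: hat x :> 'M[R]_3.
  apply/matrixP => -[[|[|[|//]]] i3] [[|[|[|//]]] j3];
    rewrite !mxE /= ?mxE; ring.
have hat0 : hat 0 = 0 :> 'M[R]_3 by rewrite -(scale0r 0) hatZ scale0r.
rewrite /S (big_morph _ hatD hat0) /Gmx !mulmx_sumr !mulmx_suml -sumrB.
apply: eq_bigr => i _; rewrite hatZ hat_cross !trmx_mul !trmxK scalerBr.
by rewrite -!(scalemxAl, scalemxAr) !mulmxA.
Qed.

(* (Rbar, gbar) solves the observer driven by the measured rate Omegaz. *)
Definition observer_solution (R : realType) (kR kg : R)
    (G : R -> 'M[R]_3) (Rt : R -> 'M[R]_3) (Omegaz : R -> 'cV[R]_3)
    (Rbar : R -> 'M[R]_3) (gbar : R -> 'cV[R]_3) : Prop :=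
  forall t, 0 <= t ->
    let eR := err_R (G t) (Rt t) (Rbar t) in
    [/\ SO3 (Rbar t),
        has_time_deriv Rbar t (Rbar t *m hat (Omegaz t - gbar t - kR *: eR)) &
        has_time_deriv gbar t (kg *: eR)].

Definition est_error (R : realType) (Rt : R -> 'M[R]_3) (gamma : 'cV[R]_3)
    (Rbar : R -> 'M[R]_3) (gbar : R -> 'cV[R]_3) (t : R) : 'cV[R]_2 :=
  vec2 (fnorm (Rt t - Rbar t)) (fnorm (gamma - gbar t)).

Definition locally_exp_stable (R : realType) (kR kg : R)
    (G : R -> 'M[R]_3) (Rt : R -> 'M[R]_3) (Omega : R -> 'cV[R]_3)
    (gamma : 'cV[R]_3) : Prop :=
  exists delta beta sigma : R,
    [/\ 0 < delta, 0 < beta, 0 < sigma &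
      forall (Rbar : R -> 'M[R]_3) (gbar : R -> 'cV[R]_3),
        observer_solution kR kg G Rt (fun t => Omega t + gamma) Rbar gbar ->
        let z := est_error Rt gamma Rbar gbar in
        fnorm (z 0) < delta ->
        forall t, 0 <= t ->
          fnorm (z t) <= beta * fnorm (z 0) * expR (- sigma * t)].

Definition M1 (R : realType) (c1 kg mu : R) : 'M[R]_2 :=
  mx_of_rows 2 2
    [:: [:: 4^-1 * c1; - (Num.sqrt 2 / 2 * mu)];
        [:: - (Num.sqrt 2 / 2 * mu); (2 * kg)^-1]].

Definition M2 (R : realType) (c2 kg mu : R) : 'M[R]_2 :=
  mx_of_rows 2 2
    [:: [:: 4^-1 * c2; Num.sqrt 2 / 2 * mu];
        [:: Num.sqrt 2 / 2 * mu; (2 * kg)^-1]].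

Definition M3 (R : realType) (a d c1 c2 B kR kg mu : R) : 'M[R]_2 :=
  mx_of_rows 2 2
    [:: [:: 2^-1 * ((1 - a) * c1 ^+ 2 * kR - d) - mu * c2 * kg;
            - (mu * Num.sqrt 2 * (c2 * kR + B / 2))];
        [:: - (mu * Num.sqrt 2 * (c2 * kR + B / 2));
            2 * mu * (1 - 2 * a)]].

Definition mu_bound (R : realType) (a d c1 c2 B kR kg : R) : R :=
  let A := (1 - a) * c1 ^+ 2 * kR - d in
  Num.min (Num.sqrt (c1 / (4 * kg)))
    (Num.min (A / (2 * c2 * kg))
       (2^-1 * (1 - 2 * a) * A /
          ((c2 * kR + B / 2) ^+ 2 + c2 * kg * (1 - 2 * a)))).

(* Main.v *)
Require Import Defs.
From HB Require Import structures.
From mathcomp Require Import all_boot all_order all_algebra.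
From mathcomp Require Import all_classical all_reals all_analysis.
From mathcomp Require Import ring lra.

Set Implicit Arguments.
Unset Strict Implicit.
Unset Printing Implicit Defensive.

Import Order.TTheory GRing.Theory Num.Theory.
Import numFieldNormedType.Exports.

Local Open Scope classical_set_scope.
Local Open Scope ring_scope.

(** Write [S = R^T Rbar], [tau = tr S], [e = (S - S^T)^vee], [H = R^T G R],
    [K = (tr H) I - H] and [e_g = gamma - gbar].  Then
    [|E_R|^2 = 2 (3 - tau)], [|e|^2 = (tau + 1) (3 - tau)],
    [2 (tau + 1) Psi = e . K e] and [2 (tau + 1) e_R = (tau + 1) K e - e x K e],
    so [e . e_R = (tau + 1) Psi].  By Cauchy--Schwarz this bounds [|e_R|] from
    below by [|E_R|] as long as [Psi <= 2 a c1]; the upper bound follows from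
    [K <= c2 I], which is the assumed upper bound on [Psi] at the half turns
    [Q = R (2 u u^T - I)].

    The energy [Psi + |e_g|^2 / (2 kg)] has derivative
    [<dG E_R, E_R> / 2 - kR |e_R|^2], nonpositive where the energy is below [c1],
    so its sublevel sets below [c1] are invariant.  Subtracting [mu e . e_g] gives
    a Lyapunov function lying between the quadratic forms of [M1] and [M2] in
    [(|E_R|, |e_g|)], whose derivative is at most minus that of [M3]. *)

(** * Calculus of derivatives over the half-line of times *)

Lemma time_deriv_eq (R : realType) (V : normedModType R) (f : R -> V) t v v' :
  has_time_deriv f t v -> v = v' -> has_time_deriv f t v'.
Proof. by move=> fv <-. Qed.

Lemma time_deriv_cst (R : realType) (V : normedModType R) (a : V) t :
  has_time_deriv (fun=> a) t 0.
Proof.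
rewrite /has_time_deriv (_ : (fun h => _) = (fun=> 0)); first exact: cvg_cst.
by apply/funext => h; rewrite subrr scaler0.
Qed.

Lemma time_derivD (R : realType) (V : normedModType R) (f g : R -> V) t u v :
  has_time_deriv f t u -> has_time_deriv g t v ->
  has_time_deriv (fun x => f x + g x) t (u + v).
Proof.
move=> fu gv; rewrite /has_time_deriv.
rewrite (_ : (fun h => _) = (fun h => h^-1 *: (f (t + h) - f t) +
  h^-1 *: (g (t + h) - g t))); first exact: cvgD.
by apply/funext => h; rewrite -scalerDr opprD addrACA.
Qed.

Lemma time_deriv_cvg (R : realType) (V : normedModType R) (f : R -> V) t v :
  has_time_deriv f t v ->
  f (t + h) @[h --> within [set h | 0 <= t + h] 0^'] --> f t.
Proof.
move=> fv.
have h0 : h @[h --> within [set h | 0 <= t + h] 0^'] --> (0 : R).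
  by apply: cvg_within_filter; exact: nbhs_dnbhs.
have lim_f : h *: (h^-1 *: (f (t + h) - f t)) + f t
    @[h --> within [set h | 0 <= t + h] 0^'] --> f t.
  rewrite -[X in _ --> X]add0r -(scale0r v).
  by apply: cvgD; [exact: cvgZ|exact: cvg_cst].
apply: (cvg_trans (near_eq_cvg _) lim_f).
apply: cvg_within; near=> h.
rewrite /= scalerA mulfV ?scale1r ?subrK//.
by near: h; exact: nbhs_dnbhs_neq.
Unshelve. all: by end_near. Qed.

Lemma time_derivM (R : realType) (f g : R -> R) t u v :
  has_time_deriv f t u -> has_time_deriv g t v ->
  has_time_deriv (fun x => f x * g x) t (u * g t + f t * v).
Proof.
move=> fu gv; rewrite /has_time_deriv.
rewrite (_ : (fun h => _) = (fun h => h^-1 *: (f (t + h) - f t) * g (t + h) +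
  f t * (h^-1 *: (g (t + h) - g t)))).
  apply: cvgD; first by apply: cvgM => //; exact: time_deriv_cvg gv.
  by apply: cvgM => //; exact: cvg_cst.
by apply/funext => h; rewrite /GRing.scale /=; ring.
Qed.

Lemma time_deriv_sum (R : realType) (V : normedModType R) n (f : 'I_n -> R -> V)
    t (v : 'I_n -> V) :
  (forall i, has_time_deriv (f i) t (v i)) ->
  has_time_deriv (fun x => \sum_i f i x) t (\sum_i v i).
Proof.
move=> fv; elim: n f v fv => [|n IH] f v fv.
  rewrite big_ord0 (_ : (fun x => _) = (fun=> 0)); first exact: time_deriv_cst.
  by apply/funext => x; rewrite big_ord0.
rewrite big_ord_recl (_ : (fun x => _) =
  (fun x => f ord0 x + \sum_i f (lift ord0 i) x)).
  by apply: time_derivD => //; exact: IH.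
by apply/funext => x; rewrite big_ord_recl.
Qed.

Lemma time_deriv_is_derive (R : realType) (f : R -> R) (t v : R) :
  is_derive t 1 f v -> has_time_deriv f t v.
Proof.
move=> [fd fE]; apply: cvg_within_filter.
rewrite -fE /derive; move/cvg_ex: fd => [l fl].
rewrite /derive (cvg_lim _ fl)//.
apply: (cvg_trans _ fl); apply: near_eq_cvg; near=> h.
by rewrite /= [h%:A]mulr1 (addrC h).
Unshelve. all: by end_near. Qed.

(** At an interior time the constraint [0 <= t + h] holds for all small [h], so the restricted limit
    is the two-sided one. *)
Lemma is_derive_time_deriv (R : realType) (f : R -> R) (t v : R) :
  0 < t -> has_time_deriv f t v -> is_derive t 1 f v.
Proof.
move=> t0 fv.
have fv' : h^-1 *: ((f \o shift t) (h *: 1) - f t) @[h --> 0^'] --> v.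
  have th0 : \forall h \near 0^', 0 <= t + h.
    apply: nbhs_dnbhs; near=> h; rewrite -lerBlDl sub0r.
    by apply: ltW; near: h; apply: lt_nbhsr; rewrite oppr_lt0.
  move=> A /fv /(filterI th0); apply: filterS => h [th /(_ th)].
  by rewrite /= [h%:A]mulr1 (addrC h).
by apply: DeriveDef; [apply/cvg_ex; exists v|exact: cvg_lim].
Unshelve. all: by end_near. Qed.

(** * Monotonicity and comparison from bounds on the derivative *)

(** The mean value theorem on [[0, t]], which asks for a derivative inside and only for continuity
    at the ends. *)
Lemma time_deriv_le0_nincr (R : realType) (f df : R -> R) :
  (forall t, 0 <= t -> has_time_deriv f t (df t)) ->
  (forall t, 0 <= t -> df t <= 0) ->
  forall t, 0 <= t -> f t <= f 0.
Proof.
move=> fd df0 t; rewrite le_eqVlt => /predU1P[<-//|t0].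
have fD (x : R) : 0 < x -> is_derive x 1 f (df x).
  by move=> x0; apply: is_derive_time_deriv => //; exact/fd/ltW.
have fc (x : R) : 0 < x -> {for x, continuous f}.
  by move=> /fD[/derivable1_diffP /differentiable_continuous].
have [||x] := @MVT R f df 0 t t0.
- by move=> x; rewrite in_itv/= => /andP[/fD].
- apply/continuous_within_itvP => //; split.
  + by move=> x; rewrite in_itv/= => /andP[/fc].
  (* Only right continuity is required at 0; the one-sided derivative gives it, as every [h > 0] is
     an admissible increment there. *)
  + move=> A /(time_deriv_cvg (fd 0 (lexx 0))); apply: (@filterS _ (nbhs (0 : R))) => h /= Ah h0.
    by move: Ah; rewrite add0r; apply; [rewrite gt_eqF|exact: ltW].
  + by apply: cvg_at_left_filter; exact: fc.
- rewrite in_itv/= subr0 => /andP[x0 _] E; rewrite -subr_le0 E.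
  by rewrite pmulr_lle0// df0// ltW.
Qed.

Lemma mx_time_deriv_entry (R : realType) m n (F : R -> 'M[R]_(m.+1, n.+1)) t v i j :
  has_time_deriv F t v -> has_time_deriv (fun x => F x i j) t (v i j).
Proof.
move=> Fv; rewrite /has_time_deriv.
have lim : (h^-1 *: (F (t + h) - F t)) i j
    @[h --> within [set h | 0 <= t + h] 0^'] --> v i j.
  exact: (cvg_comp _ (fun M : 'M[R]_(m.+1, n.+1) => M i j) Fv (@coord_continuous R _ _ i j v)).
rewrite (_ : (fun h => _) = (fun h => (h^-1 *: (F (t + h) - F t)) i j))//.
by apply/funext => h; rewrite !mxE.
Qed.

(** Squaring smooths the corner of the positive part, so the chain rule survives at the zeros of
    [f]. *)
Lemma time_deriv_sqr_max0 (R : realType) (f : R -> R) t v :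
  has_time_deriv f t v ->
  has_time_deriv (fun x => Num.max 0 (f x) ^+ 2) t (2 * Num.max 0 (f t) * v).
Proof.
move=> fv; set p := fun x => Num.max 0 (f x).
(* [p^2 - p(t)^2 - 2 p(t) (f - f(t))] is quadratic in [f - f(t)] *)
have rem0 (y x : R) : 0 <= Num.max 0 y ^+ 2 - Num.max 0 x ^+ 2
    - 2 * Num.max 0 x * (y - x) <= (y - x) ^+ 2.
  have := sqr_ge0 (y - x); have := sqr_ge0 y; have := sqr_ge0 x.
  by case: (lerP 0 y) => y0; case: (lerP 0 x) => x0 *; apply/andP; split; nra.
pose q h := h^-1 * (f (t + h) - f t).
pose r h := h^-1 * (p (t + h) ^+ 2 - p t ^+ 2 - 2 * p t * (f (t + h) - f t)).
suff lim : 2 * p t * q h + r h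
    @[h --> within [set h | 0 <= t + h] 0^'] --> 2 * p t * v.
  apply: (cvg_trans _ lim); apply: near_eq_cvg; apply: nearW => h.
  by rewrite /q /r /GRing.scale /= /p; ring.
rewrite -[X in _ --> X]addr0; apply: cvgD.
  by apply: cvgM => //; exact: cvg_cst.
have df0 : f (t + h) - f t @[h --> within [set h | 0 <= t + h] 0^'] --> (0 : R).
  by rewrite -[X in _ --> X](subrr (f t)); apply: (cvgB (time_deriv_cvg fv)); exact: cvg_cst.
have bnd0 : `|q h * (f (t + h) - f t)|
    @[h --> within [set h | 0 <= t + h] 0^'] --> (0 : R).
  have v0 : `|v * 0| = 0 by rewrite mulr0 normr0.
  by rewrite -[X in _ --> X]v0; apply: cvg_norm; exact: cvgM.
apply: norm_cvg0; apply: (squeeze_cvgr _ (cvg_cst 0) bnd0).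
apply: nearW => h; rewrite normr_ge0/= /q /r !normrM -[leRHS]mulrA ler_wpM2l//.
have /andP[r0 r2] := rem0 (f (t + h)) (f t).
by rewrite ger0_norm// (le_trans r2)// -normrM -expr2 ler_norm.
Qed.

(* [- (max 0 (c - f))^2] is nondecreasing in [f] and constant where [c <= f],
   so it is monotone along the flow without knowing that [f] stays below [c]. *)
Lemma time_deriv_barrier (R : realType) (f df : R -> R) (c : R) :
  (forall t, 0 <= t -> has_time_deriv f t (df t)) ->
  (forall t, 0 <= t -> f t < c -> df t <= 0) -> f 0 < c ->
  forall t, 0 <= t -> f t <= f 0.
Proof.
move=> fd df0 f0c t t0.
pose g x := (-1) * Num.max 0 (c + (-1) * f x) ^+ 2.
pose dg x := (-1) * (2 * Num.max 0 (c - f x) * (- df x)).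
have gd x : 0 <= x -> has_time_deriv g x (dg x).
  move=> x0; refine (time_deriv_eq (time_derivM (time_deriv_cst (-1 : R) x)
    (time_deriv_sqr_max0 (time_derivD (time_deriv_cst c x)
      (time_derivM (time_deriv_cst (-1 : R) x) (fd x x0))))) _).
  by rewrite /dg !mul0r !add0r !mulN1r.
have dg0 x : 0 <= x -> dg x <= 0.
  move=> x0; rewrite /dg; case: (ltP (f x) c) => fxc.
    by have := df0 x x0 fxc; rewrite (max_r (_ : 0 <= c - f x)); [nra|lra].
  by rewrite max_l ?subr_le0// mulr0 mul0r mulr0.
have := time_deriv_le0_nincr gd dg0 t0.
rewrite /g !mulN1r lerN2 (max_r (_ : 0 <= c - f 0)); last by lra.
(* If [f t] exceeded [c], the truncation would vanish at [t], whereas its square is at least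
   [(c - f 0)^2 > 0]. *)
by case: (lerP 0 (c - f t)) => [|]; nra.
Qed.

Lemma time_deriv_exp (R : realType) (k t : R) :
  has_time_deriv (fun x => expR (k * x)) t (k * expR (k * t)).
Proof.
apply: time_deriv_is_derive.
have d : is_derive t 1 (expR \o (k \*: id)) (expR (k * t) * (k *: 1)).
  exact: is_derive1_comp.
by apply: is_derive_eq d _; rewrite [k%:A]mulr1 mulrC.
Qed.

(** The product of [f] with the integrating factor [expR (k * x)] is nonincreasing. *)
Lemma time_deriv_gronwall (R : realType) (f df : R -> R) (k : R) :
  (forall t, 0 <= t -> has_time_deriv f t (df t)) ->
  (forall t, 0 <= t -> df t <= - k * f t) ->
  forall t, 0 <= t -> f t <= f 0 * expR (- k * t).
Proof.
move=> fd dfk t t0.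
have gd x : 0 <= x -> has_time_deriv (fun x => f x * expR (k * x)) x
    ((df x + k * f x) * expR (k * x)).
  move=> x0; refine (time_deriv_eq (time_derivM (fd x x0) (@time_deriv_exp R k x)) _).
  by ring.
have := time_deriv_le0_nincr gd _ t0.
rewrite mulr0 expR0 mulr1 mulNr expRN ler_pdivlMr ?expR_gt0//; apply => x x0.
by rewrite mulr_le0_ge0 ?expR_ge0//; have := dfk x x0; lra.
Qed.

(** * Eigenvalues of symmetric 2 by 2 matrices *)

Lemma det_mx22 (R : comNzRingType) (A : 'M[R]_2) :
  \det A = A 0 0 * A 1 1 - A 0 1 * A 1 0.
Proof.
rewrite (expand_det_row _ 0) !big_ord_recl big_ord0 /cofactor !det_mx11 !mxE /=.
have e1 : lift ord0 ord0 = 1 :> 'I_2 by exact: val_inj.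
have e0 : lift (1 : 'I_2) ord0 = 0 :> 'I_2 by exact: val_inj.
by rewrite !e1 e0 /bump /= !expr0 expr1; ring.
Qed.

(* The two eigenvalues are the roots of ['X^2 - (p + r) 'X + (p r - q^2)]. *)
Lemma eigvals_mx22 (R : realType) (p q r : R) :
  let M := mx_of_rows 2 2 [:: [:: p; q]; [:: q; r]] in
  [/\ lambda_min M <= lambda_max M, lambda_min M + lambda_max M = p + r &
      lambda_min M * lambda_max M = p * r - q ^+ 2].
Proof.
move=> M.
have Msym : M^T = M.
  apply/matrixP => i j; rewrite !mxE.
  by case: i => -[|[|//]] ?; case: j => -[|[|//]] ?.
have [srt cp] := eigvalsP Msym.
have szl : size (eigvals M) = 2.
  by have := size_char_poly M; rewrite cp size_prod_XsubC => -[].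
rewrite /lambda_min /lambda_max; move: srt cp szl.
case: (eigvals M) => [|x [|y []]]// /andP[yx _] cp _ /=; split=> //.
(* The coefficients of degree one and zero of the characteristic polynomial give the sum and the
   product of its roots. *)
- have := char_poly_trace M isT; rewrite cp /= !big_cons big_nil mulr1.
  rewrite /mxtrace !big_ord_recl big_ord0 !mxE /= addr0 => E.
  apply: oppr_inj; rewrite -E coefM !big_ord_recl big_ord0 /=.
  by rewrite !coefB !coefX !coefC /=; ring.
- have := char_poly_det M; rewrite cp !big_cons big_nil mulr1 det_mx22 !mxE /=.
  by rewrite coefM big_ord_recl big_ord0 /= !coefB !coefX !coefC /=; nra.
Qed.

(** With [I] the identity, [M - lambda_min M I] and [lambda_max M I - M] have zero determinant and
    nonnegative trace, hence nonnegative quadratic forms. *)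
Lemma lambda_mx22_bounds (R : realType) (p q r a b : R) :
  let M := mx_of_rows 2 2 [:: [:: p; q]; [:: q; r]] in
  let quad := p * a ^+ 2 + 2 * q * (a * b) + r * b ^+ 2 in
  lambda_min M * (a ^+ 2 + b ^+ 2) <= quad /\
  quad <= lambda_max M * (a ^+ 2 + b ^+ 2).
Proof.
move=> M quad; have [] := eigvals_mx22 p q r; rewrite -/M /quad {quad}.
move: (lambda_min M) (lambda_max M) => y x yx sxy pxy.
have psd (u v w : R) : 0 <= u + w -> u * w = v ^+ 2 ->
    0 <= u * a ^+ 2 + 2 * v * (a * b) + w * b ^+ 2.
  move=> uw0 uw.
  (* For [u > 0] the form times [u] is a perfect square; otherwise zero determinant and nonnegative
     trace force [u = v = 0]. *)
  have [u0|] := ltP 0 u.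
    rewrite -(pmulr_rge0 _ u0).
    have -> : u * (u * a ^+ 2 + 2 * v * (a * b) + w * b ^+ 2) =
      (u * a + v * b) ^+ 2 + (u * w - v ^+ 2) * b ^+ 2 by ring.
    by rewrite uw subrr mul0r addr0 sqr_ge0.
  move=> u0; have u_eq0 : u = 0 by have := sqr_ge0 v; nra.
  have v_eq0 : v = 0 by apply/eqP; rewrite -sqrf_eq0 -uw u_eq0 mul0r.
  move: uw0; rewrite u_eq0 v_eq0 !(mul0r, mulr0, add0r) => w0.
  by rewrite mulr_ge0 ?sqr_ge0.
split; rewrite -subr_ge0.
- have := psd (p - y) q (r - y); rewrite (_ : (p - y) * (r - y) = q ^+ 2); last by nra.
  by move=> /(_ _ erefl) P; apply: le_trans (P _) _; [lra|nra].
- have := psd (x - p) (- q) (x - r); rewrite (_ : (x - p) * (x - r) = (- q) ^+ 2); last by nra.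
  by move=> /(_ _ erefl) P; apply: le_trans (P _) _; [lra|nra].
Qed.

(** Sylvester's criterion: the trace and the determinant are positive, hence so are both
    eigenvalues. *)
Lemma lambda_mx22_gt0 (R : realType) (p q r : R) :
  let M := mx_of_rows 2 2 [:: [:: p; q]; [:: q; r]] in
  0 < p -> q ^+ 2 < p * r -> 0 < lambda_min M /\ 0 < lambda_max M.
Proof.
move=> M p0 qpr; have [] := eigvals_mx22 p q r; rewrite -/M.
move: (lambda_min M) (lambda_max M) => y x yx sxy pxy.
have r0 : 0 < r by rewrite -(pmulr_rgt0 _ p0); apply: le_lt_trans qpr; exact: sqr_ge0.
have x0 : 0 < x by lra.
by split=> //; rewrite -(pmulr_lgt0 _ x0) pxy subr_gt0.
Qed.

(** * The Frobenius inner product and norm *)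

Section InnerTheory.
Variables (R : realType) (m n : nat).
Implicit Types A B C : 'M[R]_(m, n).

Lemma inner_sum A B : inner A B = \sum_i \sum_j A i j * B i j.
Proof.
rewrite /inner /mxtrace exchange_big /=; apply: eq_bigr => j _.
by rewrite !mxE; apply: eq_bigr => i _; rewrite !mxE.
Qed.

Lemma innerC A B : inner A B = inner B A.
Proof.
by rewrite !inner_sum; apply: eq_bigr => i _; apply: eq_bigr => j _; rewrite mulrC.
Qed.

Lemma innerDl A B C : inner (A + B) C = inner A C + inner B C.
Proof. by rewrite /inner raddfD /= mulmxDl raddfD. Qed.

Lemma innerZl (k : R) A B : inner (k *: A) B = k * inner A B.
Proof. by rewrite /inner linearZ /= -scalemxAl linearZ. Qed.

Lemma innerDr A B C : inner A (B + C) = inner A B + inner A C.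
Proof. by rewrite !(innerC A) innerDl. Qed.

Lemma innerZr (k : R) A B : inner A (k *: B) = k * inner A B.
Proof. by rewrite !(innerC A) innerZl. Qed.

Lemma innerNl A B : inner (- A) B = - inner A B.
Proof. by rewrite -scaleN1r innerZl mulN1r. Qed.

Lemma innerNr A B : inner A (- B) = - inner A B.
Proof. by rewrite !(innerC A) innerNl. Qed.

Lemma inner0l A : inner 0 A = 0.
Proof. by rewrite -(scale0r 0) innerZl mul0r. Qed.

Lemma inner0r A : inner A 0 = 0.
Proof. by rewrite innerC inner0l. Qed.

Lemma inner_ge0 A : 0 <= inner A A.
Proof.
rewrite inner_sum; apply: sumr_ge0 => i _; apply: sumr_ge0 => j _.
by rewrite -expr2 sqr_ge0.
Qed.

Lemma inner_eq0 A : inner A A = 0 -> A = 0.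
Proof.
rewrite inner_sum => /eqP; rewrite psumr_eq0 => [/allP A0|i _]; last first.
  by apply: sumr_ge0 => j _; rewrite -expr2 sqr_ge0.
apply/matrixP => i j; rewrite mxE.
have := A0 i (mem_index_enum _); rewrite /= psumr_eq0 => [/allP Ai0|k _]; last first.
  by rewrite -expr2 sqr_ge0.
by have := Ai0 j (mem_index_enum _); rewrite /= -expr2 sqrf_eq0 => /eqP.
Qed.

Lemma inner_CauchySchwarz A B : inner A B ^+ 2 <= inner A A * inner B B.
Proof.
have [/inner_eq0 ->|/eqP B0] := eqVneq (inner B B) 0.
  by rewrite !inner0r mulr0 expr0n.
have {B0} Bgt0 : 0 < inner B B by rewrite lt_neqAle eq_sym (inner_ge0 B) andbT; apply/eqP.
(* This vector is [inner B B] times the component of [A] orthogonal to [B]. *)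
have := inner_ge0 (inner B B *: A - inner A B *: B).
rewrite !(innerDl, innerDr, innerNl, innerNr, innerZl, innerZr) (innerC B A) => P.
rewrite -subr_ge0 -(pmulr_rge0 _ Bgt0); apply: le_trans P _.
by rewrite le_eqVlt; apply/orP; left; apply/eqP; ring.
Qed.

Lemma fnorm_ge0 A : 0 <= fnorm A. Proof. exact: sqrtr_ge0. Qed.

Lemma fnorm_sqr A : fnorm A ^+ 2 = inner A A.
Proof. by rewrite sqr_sqrtr ?inner_ge0. Qed.

Lemma ler_inner_fnorm A B : `|inner A B| <= fnorm A * fnorm B.
Proof.
rewrite -ler_sqr ?nnegrE ?mulr_ge0 ?fnorm_ge0// real_normK ?num_real // exprMn !fnorm_sqr.
exact: inner_CauchySchwarz.
Qed.

End InnerTheory.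

Lemma inner_mulmxl (R : realType) (m n p : nat) (A : 'M[R]_(m, n)) (B : 'M[R]_(n, p)) C :
  inner (A *m B) C = inner B (A^T *m C).
Proof. by rewrite /inner trmx_mul mulmxA. Qed.

(** Each entry of the product pairs a row of [A] with a column of [B]; Cauchy--Schwarz applies entry
    by entry. *)
Lemma fnorm_mulmx (R : realType) (m n p : nat) (A : 'M[R]_(m, n)) (B : 'M[R]_(n, p)) :
  fnorm (A *m B) <= fnorm A * fnorm B.
Proof.
rewrite -ler_sqr ?nnegrE ?mulr_ge0 ?fnorm_ge0// exprMn !fnorm_sqr.
rewrite inner_sum [inner A A]inner_sum.
rewrite (_ : inner B B = \sum_j \sum_k B k j ^+ 2); last first.
  by rewrite inner_sum exchange_big.
rewrite mulr_suml; apply: ler_sum => i _.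
rewrite mulr_sumr; apply: ler_sum => j _.
have := inner_CauchySchwarz (row i A)^T (col j B).
have rw (x y : 'cV[R]_n) : inner x y = \sum_k x k 0 * y k 0.
  by rewrite inner_sum; apply: eq_bigr => k _; rewrite big_ord1.
rewrite !rw -expr2 mxE.
by under eq_bigr do rewrite !mxE; under [X in _ <= X * _]eq_bigr do rewrite !mxE;
  under [X in _ <= _ * X]eq_bigr do rewrite !mxE -expr2.
Qed.

(** * Algebra of 3 by 3 matrices, rotations and cross products *)

Lemma sum_ord3 (V : nmodType) (F : 'I_3 -> V) : \sum_i F i = F 0 + F 1 + F 2.
Proof.
by rewrite !big_ord_recl big_ord0 addr0 addrA; congr (_ + F _ + F _); exact: val_inj.
Qed.

Lemma ord3P (P : 'I_3 -> Prop) : P 0 -> P 1 -> P 2 -> forall i, P i.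
Proof.
move=> P0 P1 P2 [[|[|[|//]]] i3].
- by rewrite (_ : Ordinal _ = 0)//; exact: val_inj.
- by rewrite (_ : Ordinal _ = 1)//; exact: val_inj.
- by rewrite (_ : Ordinal _ = 2)//; exact: val_inj.
Qed.

Lemma matrix3P (R : Type) n (A B : 'M[R]_(3, n)) :
  (forall j, A 0 j = B 0 j) -> (forall j, A 1 j = B 1 j) ->
  (forall j, A 2 j = B 2 j) -> A = B.
Proof. by move=> *; apply/matrixP; elim/ord3P. Qed.

Lemma det_mx33 (R : comNzRingType) (A : 'M[R]_3) :
  \det A = A 0 0 * (A 1 1 * A 2 2 - A 1 2 * A 2 1)
         - A 0 1 * (A 1 0 * A 2 2 - A 1 2 * A 2 0)
         + A 0 2 * (A 1 0 * A 2 1 - A 1 1 * A 2 0).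
Proof.
rewrite (expand_det_row _ 0) sum_ord3 /cofactor !det_mx22 !mxE /=.
have e00 : lift (0 : 'I_3) (0 : 'I_2) = 1 by exact: val_inj.
have e01 : lift (0 : 'I_3) (1 : 'I_2) = 2 by exact: val_inj.
have e10 : lift (1 : 'I_3) (0 : 'I_2) = 0 by exact: val_inj.
have e11 : lift (1 : 'I_3) (1 : 'I_2) = 2 by exact: val_inj.
have e20 : lift (2 : 'I_3) (0 : 'I_2) = 0 by exact: val_inj.
have e21 : lift (2 : 'I_3) (1 : 'I_2) = 1 by exact: val_inj.
rewrite !(e00, e01, e10, e11, e20, e21).
by rewrite /bump /= expr0 expr1 expr2; ring.
Qed.

Lemma inner_cV3 (R : realType) (x y : 'cV[R]_3) :
  inner x y = x 0 0 * y 0 0 + x 1 0 * y 1 0 + x 2 0 * y 2 0.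
Proof. by rewrite inner_sum sum_ord3 !big_ord1. Qed.

Ltac mx3_expand := rewrite /mxtrace; do 5 rewrite ?mxE ?sum_ord3 ?big_ord1 /=.

(* Cayley--Hamilton, with the adjugate [S^T] in place of [S^-1] *)
Lemma SO3_cayley_hamilton (R : realType) (S : 'M[R]_3) : SO3 S ->
  S *m S = \tr S *: S - (\tr S)%:M + S^T.
Proof.
move=> [SS dS].
(* The adjugate of a 3 by 3 matrix written through its invariants; for a rotation it is the inverse,
   that is the transpose. *)
pose adjS := S *m S - \tr S *: S + (2^-1 * ((\tr S) ^+ 2 - \tr (S *m S)))%:M.
have adjE : S *m adjS = (\det S)%:M.
  rewrite det_mx33 /adjS /mxtrace !sum_ord3.
  by apply: matrix3P; elim/ord3P; mx3_expand; field.
have {adjE} adjE : adjS = S^T.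
  by rewrite -[LHS]mul1mx -SS -mulmxA adjE dS mulmx1.
(* Comparing traces in [adjS = S^T] identifies the second invariant of a rotation with its trace. *)
have trE : 2^-1 * ((\tr S) ^+ 2 - \tr (S *m S)) = \tr S.
  have := congr1 mxtrace adjE.
  rewrite /adjS mxtrace_tr !raddfD /= linearN /= linearZ /= mxtrace_scalar.
  lra.
by rewrite -adjE /adjS trE [RHS]addrC addrACA subrK subrr addr0.
Qed.

Lemma vee_is_linear (R : realType) : linear (@vee R).
Proof. by move=> k A B; apply: matrix3P => j; rewrite !ord1; mx3_expand; ring. Qed.
HB.instance Definition _ (R : realType) :=
  GRing.isLinear.Build R 'M[R]_3 'cV[R]_3 _ (@vee R) (@vee_is_linear R).

(** Only the skew part of [A] pairs with the skew matrix [hat v]. *)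
Lemma tr_mul_hat (R : realType) (A : 'M[R]_3) (v : 'cV[R]_3) :
  \tr (A *m hat v) = - inner (vee (A - A^T)) v.
Proof. by rewrite inner_cV3; mx3_expand; ring. Qed.

Lemma tr_sym_mul_hat (R : realType) (A : 'M[R]_3) (v : 'cV[R]_3) :
  A^T = A -> \tr (A *m hat v) = 0.
Proof. by move=> As; rewrite tr_mul_hat As subrr linear0 inner0l oppr0. Qed.

Lemma inner_cross_vec (R : realType) (x y : 'cV[R]_3) : inner x (cross x y) = 0.
Proof. by rewrite inner_cV3; mx3_expand; ring. Qed.

Lemma cross_sqr (R : realType) (x y : 'cV[R]_3) :
  inner (cross x y) (cross x y) = inner x x * inner y y - inner x y ^+ 2.
Proof. by rewrite !inner_cV3; mx3_expand; ring. Qed.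

(** Since [S - S^T = hat e], this is the double cross product [e x (e x y)] in matrix form. *)
Lemma skew_square (R : realType) (S : 'M[R]_3) (e := vee (S - S^T)) :
  (S - S^T) *m (S - S^T) = e *m e^T - (inner e e)%:M.
Proof.
by rewrite inner_cV3; apply: matrix3P; elim/ord3P; mx3_expand; ring.
Qed.

(** * The axis vector of a rotation and its relation to the error vector *)

Section RotationAxis.
Variables (R : realType) (S : 'M[R]_3).
Hypothesis SO3_S : SO3 S.
Let tau := \tr S.
(* [tau = 1 + 2 cos theta] and [e = 2 sin theta u] for the rotation by [theta]
   about the axis [u] *)
Let e := vee (S - S^T).

(** Cayley--Hamilton removes the squares of [S] and [S^T] from the square of the skew part. *)
Let axis_square :
  e *m e^T - (inner e e)%:M = (tau + 1) *: (S + S^T) - (2 * (tau + 1))%:M.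
Proof.
have [SS _] := SO3_S.
have CH := SO3_cayley_hamilton SO3_S.
have CHT : S^T *m S^T = tau *: S^T - tau%:M + S.
  by rewrite -trmx_mul CH !raddfD /= !linearN /= linearZ /= trmxK tr_scalar_mx.
rewrite -skew_square mulmxBr !mulmxBl CH CHT SS (mulmx1C SS) -/tau.
by apply/matrixP => i j; rewrite !mxE; ring.
Qed.

Lemma SO3_axis_sqr : inner e e = (tau + 1) * (3 - tau).
Proof.
have := congr1 mxtrace axis_square.
rewrite !linearB /= linearZ /= raddfD /= mxtrace_tr !mxtrace_scalar mxtrace_mulC.
rewrite -/(inner e e) -/tau; lra.
Qed.

(** Symmetric part of Rodrigues' formula, multiplied by [tau + 1] so that no division by it
    occurs. *)
Lemma SO3_sym_part : (tau + 1) *: (S + S^T) = e *m e^T + ((tau + 1) * (tau - 1))%:M.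
Proof.
rewrite -[LHS](subrK (2 * (tau + 1))%:M) -axis_square SO3_axis_sqr.
by apply/matrixP => i j; rewrite !mxE; ring.
Qed.

Section ErrorVector.
Variable H : 'M[R]_3.
Hypothesis Hsym : H^T = H.
Let K (x : 'cV[R]_3) := \tr H *: x - H *m x.
Let eH := vee (H *m S - S^T *m H).

(** The skew part of [S] contributes [K e]. In the symmetric part, scaled by [tau + 1], the scalar
    matrix commutes with [H], and [e *m e^T] leaves [e x H e = - e x K e]. *)
Lemma SO3_err_decomp :
  (2 * (tau + 1)) *: eH = (tau + 1) *: K e - cross e (K e).
Proof.
have Hij i j : H i j = H j i by rewrite -{1}Hsym mxE.
(* For symmetric [H], [H hat(e) + hat(e) H = hat(K e)]. *)
have split_eH : 2 *: eH = vee (H *m (S + S^T) - (S + S^T) *m H) + K e.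
  rewrite /eH /K /e; apply: matrix3P => j; rewrite !ord1; mx3_expand;
    rewrite ?(Hij 1 0) ?(Hij 2 0) ?(Hij 2 1); ring.
rewrite mulrC -scalerA split_eH scalerDr -linearZ /=.
rewrite scalerBr scalemxAr scalemxAl SO3_sym_part addrC; congr (_ + _).
rewrite /K; apply: matrix3P => j; rewrite !ord1; mx3_expand;
  rewrite ?(Hij 1 0) ?(Hij 2 0) ?(Hij 2 1); ring.
Qed.

(** A symmetric [H] sees only the symmetric part of [S] under the trace, and that part is known in
    terms of [e]. *)
Lemma SO3_potential :
  2 * (tau + 1) * (\tr H - \tr (H *m S)) = inner e (K e).
Proof.
have trHS : 2 * \tr (H *m S) = \tr (H *m (S + S^T)).
  rewrite mulmxDr raddfD /= -[in X in _ + X]mxtrace_tr trmx_mul trmxK Hsym.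
  by rewrite [in X in _ + X]mxtrace_mulC; ring.
have -> : 2 * (tau + 1) * (\tr H - \tr (H *m S)) =
    2 * (tau + 1) * \tr H - (tau + 1) * (2 * \tr (H *m S)) by ring.
rewrite trHS -mxtraceZ scalemxAr SO3_sym_part mulmxDr raddfD /= mul_mx_scalar.
rewrite mxtraceZ mulmxA mxtrace_mulC /K innerDr innerNr innerZr SO3_axis_sqr.
by rewrite -/(inner e (H *m e)); ring.
Qed.

End ErrorVector.
End RotationAxis.

(** * The potential in the relative rotation, and the form it bounds *)

(** Nonnegativity of the form at [c x - M x], with its upper bound at [M x], gives
    [|M x|^2 <= c (x . M x)]; the upper bound at [x] concludes. *)
Lemma sym_form_op_bound (R : realType) n (M : 'M[R]_n) (c : R) : M^T = M -> 0 < c ->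
  (forall x : 'cV[R]_n, 0 <= inner x (M *m x) <= c * inner x x) ->
  forall x : 'cV[R]_n, inner (M *m x) (M *m x) <= c ^+ 2 * inner x x.
Proof.
move=> Msym c0 Mb x; set y := M *m x.
have xMy : inner x (M *m y) = inner y y by rewrite [RHS]inner_mulmxl Msym.
have /andP[_ xb] := Mb x; have /andP[_ yb] := Mb y.
have /andP[+ _] := Mb (c *: x - y).
rewrite mulmxBr -scalemxAr -/y.
rewrite !(innerDl, innerDr, innerNl, innerNr, innerZl, innerZr) xMy => zb.
rewrite -/y in xb; move: (inner y y) (inner x y) (inner x x) (inner y (M *m y)) xb yb zb.
move=> r p q s xb yb zb.
have : c * (r - c * p) <= 0 by nra.
by rewrite pmulr_rle0//; nra.
Qed.

Lemma SO3_mul (R : realType) (A B : 'M[R]_3) : SO3 A -> SO3 B -> SO3 (A *m B).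
Proof.
move=> [AA dA] [BB dB]; split; last by rewrite det_mulmx dA dB mulr1.
by rewrite trmx_mul -mulmxA (mulmxA A^T) AA mul1mx.
Qed.

Lemma SO3_tr (R : realType) (A : 'M[R]_3) : SO3 A -> SO3 A^T.
Proof. by move=> [AA dA]; split; [rewrite trmxK; exact: mulmx1C|rewrite det_tr]. Qed.

(** Here [E_R = Q (1 - S)], and [S *m S^T = 1] turns the quadratic term of the expansion back into
    [\tr H], with [H = Q^T G Q]. *)
Lemma Psi_relative (R : realType) (G Q S : 'M[R]_3) : G^T = G -> SO3 Q -> SO3 S ->
  Psi G Q (Q *m S) = \tr (Q^T *m G *m Q) - \tr (Q^T *m G *m Q *m S).
Proof.
move=> Gsym [QQ _] /SO3_tr[SS _]; rewrite trmxK in SS.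
set H := Q^T *m G *m Q.
have Hsym : H^T = H by rewrite /H !trmx_mul trmxK Gsym mulmxA.
have QE : Q - Q *m S = Q *m (1%:M - S) by rewrite mulmxBr mulmx1.
have -> : Psi G Q (Q *m S) = 2^-1 * \tr ((1%:M - S)^T *m H *m (1%:M - S)).
  by rewrite /Psi QE innerC /inner trmx_mul /H !mulmxA.
rewrite [(1%:M - S)^T]raddfB /= trmx1 mulmxBl mul1mx mulmxBr mulmx1 mulmxBl.
rewrite !raddfB /= -(mulmxA _ H S) (mxtrace_mulC S^T (H *m S)) -(mulmxA H S) SS mulmx1.
rewrite -[\tr (S^T *m H)]mxtrace_tr trmx_mul trmxK Hsym; lra.
Qed.

Lemma dist_relative (R : realType) (Q S : 'M[R]_3) : SO3 Q -> SO3 S ->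
  fnorm (Q - Q *m S) ^+ 2 = 2 * (3 - \tr S).
Proof.
move=> hQ hS; have [QQ _] := hQ.
(* With [G] the identity the potential is half the squared distance. *)
have := @Psi_relative R 1%:M Q S (trmx1 _ _) hQ hS.
rewrite /Psi mulmx1 QQ mul1mx mxtrace1 -fnorm_sqr mul1mx; lra.
Qed.

Lemma SO3_half_turn (R : realType) (u : 'cV[R]_3) : inner u u = 1 ->
  SO3 (2 *: (u *m u^T) - 1%:M).
Proof.
move=> u1; have uu : u^T *m u = 1%:M.
  by apply/matrixP => i j; rewrite !ord1 !mxE sum_ord3 !mxE -inner_cV3 u1.
split.
  have -> : (2 *: (u *m u^T) - 1%:M)^T = 2 *: (u *m u^T) - 1%:M.
    by rewrite linearB /= trmx1 linearZ /= trmx_mul trmxK.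
  rewrite mulmxBr mulmxBl mulmx1 mul1mx -scalemxAl -scalemxAr.
  rewrite -mulmxA (mulmxA u^T) uu mul1mx.
  by apply/matrixP => i j; rewrite !mxE; ring.
suff -> : \det (2 *: (u *m u^T) - 1%:M) = 2 * inner u u - 1 by rewrite u1; ring.
by rewrite det_mx33 inner_cV3; mx3_expand; ring.
Qed.

(** At the half turn about a unit vector [u], the squared distance is 8 and the potential is
    [2 (u . K u)], so the assumed bounds become [c1 <= u . K u <= c2]; other vectors follow by
    scaling. *)
Lemma Psi_bounds_form (R : realType) (G Q : 'M[R]_3) (c1 c2 : R) : G^T = G -> SO3 Q ->
  (forall Q' : 'M[R]_3, SO3 Q' ->
     4^-1 * c1 * fnorm (Q - Q') ^+ 2 <= Psi G Q Q' /\
     Psi G Q Q' <= 4^-1 * c2 * fnorm (Q - Q') ^+ 2) ->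
  let H := Q^T *m G *m Q in
  forall x : 'cV[R]_3,
    c1 * inner x x <= inner x (((\tr H)%:M - H) *m x) <= c2 * inner x x.
Proof.
move=> Gsym hQ hPsi H.
have unit (u : 'cV[R]_3) : inner u u = 1 ->
    c1 <= inner u (((\tr H)%:M - H) *m u) <= c2.
  move=> u1; have hS := SO3_half_turn u1.
  have [] := hPsi _ (SO3_mul hQ hS).
  rewrite dist_relative// Psi_relative// -/H.
  rewrite mulmxBr -scalemxAr mulmx1 mulmxA !raddfB /= mxtrace1 !mxtraceZ.
  rewrite (mxtrace_mulC u) (mxtrace_mulC _ u^T) -/(inner u u) -/(inner u (H *m u)) u1.
  rewrite mulmxBl mul_scalar_mx innerDr innerNr innerZr u1 => *.
  by apply/andP; split; lra.
move=> x; have [x0|xN0] := eqVneq (inner x x) 0.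
  by rewrite (inner_eq0 x0) mulmx0 !inner0r !mulr0 lexx.
have nx0 : fnorm x != 0 by rewrite -sqrf_eq0 fnorm_sqr.
have /unit : inner ((fnorm x)^-1 *: x) ((fnorm x)^-1 *: x) = 1.
  by rewrite innerZl innerZr -fnorm_sqr; field.
rewrite -scalemxAr innerZl innerZr mulrA -expr2 exprVn fnorm_sqr mulrC.
have x0 : 0 < inner x x by rewrite lt_neqAle eq_sym xN0 inner_ge0.
by rewrite ler_pdivlMr// ler_pdivrMr.
Qed.

(** * Two-sided estimates of the error vector away from half turns *)

Section ErrorBounds.
Variables (R : realType) (S H : 'M[R]_3) (c : R).
Hypotheses (SO3_S : SO3 S) (Hsym : H^T = H) (c_gt0 : 0 < c).
Hypothesis form_bound : forall x : 'cV[R]_3,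
  0 <= inner x (((\tr H)%:M - H) *m x) <= c * inner x x.
Let tau := \tr S.
Hypothesis tau_gt : 0 < tau + 1.
Let psi := \tr H - \tr (H *m S).
Let e := vee (S - S^T).
Let eH := vee (H *m S - S^T *m H).

Let formE (x : 'cV[R]_3) : ((\tr H)%:M - H) *m x = \tr H *: x - H *m x.
Proof. by rewrite mulmxBl mul_scalar_mx. Qed.

(** Pairing the decomposition of [eH] with [e] kills the cross product; then [tau + 1] cancels. *)
Lemma err_axis_inner : inner e eH = (tau + 1) * psi.
Proof.
have /(congr1 (inner e)) := SO3_err_decomp SO3_S Hsym.
rewrite -/tau -/e -/eH innerDr innerNr inner_cross_vec !innerZr.
rewrite -(SO3_potential SO3_S Hsym) -/tau -/psi => E.
have : 2 * (tau + 1) * (inner e eH - (tau + 1) * psi) = 0 by rewrite mulrBr E; ring.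
move/eqP; rewrite mulf_eq0 => /orP[/eqP|]; last by rewrite subr_eq0 => /eqP.
by move=> ?; exfalso; move: tau_gt; lra.
Qed.

(** The two terms of the decomposition are orthogonal, and [(tau + 1)^2 + |e|^2 = 4 (tau + 1)], so
    [(tau + 1) |eH|^2 <= |K e|^2 <= c^2 |e|^2]. *)
Lemma err_upper : inner eH eH <= (3 - tau) * c ^+ 2.
Proof.
have Msym : ((\tr H)%:M - H)^T = (\tr H)%:M - H.
  by rewrite raddfB /= tr_scalar_mx Hsym.
have Kb := sym_form_op_bound Msym c_gt0 form_bound e.
rewrite formE in Kb; set Ke := \tr H *: e - H *m e in Kb.
have decomp := SO3_err_decomp SO3_S Hsym; rewrite -/tau -/e -/eH -/Ke in decomp.
move: Ke Kb decomp => Ke Kb decomp.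
have : inner ((2 * (tau + 1)) *: eH) ((2 * (tau + 1)) *: eH) =
    inner ((tau + 1) *: Ke - cross e Ke) ((tau + 1) *: Ke - cross e Ke).
  by rewrite decomp.
rewrite !(innerDl, innerDr, innerNl, innerNr, innerZl, innerZr).
rewrite (innerC (cross e Ke) Ke).
have -> : inner Ke (cross e Ke) = 0 by rewrite inner_cV3; mx3_expand; ring.
rewrite cross_sqr (SO3_axis_sqr SO3_S) -/tau => E.
rewrite (SO3_axis_sqr SO3_S) -/tau in Kb.
have sq := sqr_ge0 (inner e Ke).
rewrite -(ler_pM2l (mulr_gt0 tau_gt tau_gt)) -(ler_pM2l (_ : 0 < 4 :> R))//.
have Kb' := ler_wpM2l (ltW tau_gt) Kb.
by move: E Kb' sq; lra.
Qed.

Lemma err_lower : (tau + 1) * psi ^+ 2 <= inner eH eH * (3 - tau).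
Proof.
have := inner_CauchySchwarz e eH.
rewrite err_axis_inner (SO3_axis_sqr SO3_S) -/tau => E.
rewrite -(ler_pM2l tau_gt); move: E; lra.
Qed.

End ErrorBounds.

(** * Derivatives of matrix-valued functions *)

(** Stated entrywise, so that products, transposes and inner products reduce to scalar rules. *)
Definition mx_time_deriv (R : realType) m n (F : R -> 'M[R]_(m, n)) t (dF : 'M[R]_(m, n)) :=
  forall i j, has_time_deriv (fun x => F x i j) t (dF i j).

Section MatrixTimeDeriv.
Variable R : realType.

Lemma time_deriv_ext (V : normedModType R) (f g : R -> V) t v : f =1 g ->
  has_time_deriv f t v -> has_time_deriv g t v.
Proof. by move=> /funext ->. Qed.

Lemma time_deriv_mx m n (F : R -> 'M[R]_(m.+1, n.+1)) t dF :
  has_time_deriv F t dF -> mx_time_deriv F t dF.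
Proof. by move=> FdF i j; exact: mx_time_deriv_entry. Qed.

Lemma mx_time_deriv_cst m n (A : 'M[R]_(m, n)) t : mx_time_deriv (fun=> A) t 0.
Proof. by move=> i j; rewrite mxE; exact: time_deriv_cst. Qed.

Lemma mx_time_derivB m n (F G : R -> 'M[R]_(m, n)) t dF dG :
  mx_time_deriv F t dF -> mx_time_deriv G t dG ->
  mx_time_deriv (fun x => F x - G x) t (dF - dG).
Proof.
move=> FdF GdG i j; rewrite !mxE -mulN1r.
apply: (@time_deriv_ext _ (fun x => F x i j + (-1) * G x i j)).
  by move=> x; rewrite !mxE mulN1r.
apply: time_derivD => //.
refine (time_deriv_eq (time_derivM (time_deriv_cst (-1 : R) t) (GdG i j)) _).
by rewrite mul0r add0r.
Qed.

Lemma mx_time_derivM m n p (F : R -> 'M[R]_(m, n)) (G : R -> 'M[R]_(n, p)) t dF dG :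
  mx_time_deriv F t dF -> mx_time_deriv G t dG ->
  mx_time_deriv (fun x => F x *m G x) t (dF *m G t + F t *m dG).
Proof.
move=> FdF GdG i j; rewrite !mxE -big_split /=.
apply: (@time_deriv_ext _ (fun x => \sum_k F x i k * G x k j)).
  by move=> x; rewrite !mxE.
by apply: time_deriv_sum => k; exact: time_derivM.
Qed.

Lemma mx_time_deriv_tr m n (F : R -> 'M[R]_(m, n)) t dF :
  mx_time_deriv F t dF -> mx_time_deriv (fun x => (F x)^T) t dF^T.
Proof.
move=> FdF i j; rewrite mxE; apply: time_deriv_ext (FdF j i).
by move=> x; rewrite mxE.
Qed.

Lemma time_deriv_inner m n (F G : R -> 'M[R]_(m, n)) t dF dG :
  mx_time_deriv F t dF -> mx_time_deriv G t dG ->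
  has_time_deriv (fun x => inner (F x) (G x)) t (inner dF (G t) + inner (F t) dG).
Proof.
move=> FdF GdG; rewrite !inner_sum -big_split /=.
apply: (@time_deriv_ext _ (fun x => \sum_i \sum_j F x i j * G x i j)).
  by move=> x; rewrite inner_sum.
apply: time_deriv_sum => i; rewrite -big_split.
by apply: time_deriv_sum => j; exact: time_derivM.
Qed.

Lemma mx_time_deriv_vee (F : R -> 'M[R]_3) t dF :
  mx_time_deriv F t dF -> mx_time_deriv (fun x => vee (F x)) t (vee dF).
Proof.
move=> FdF; elim/ord3P => j; rewrite ord1 mxE /=.
- by apply: time_deriv_ext (FdF 2 1) => x; rewrite mxE.
- by apply: time_deriv_ext (FdF 0 2) => x; rewrite mxE.
- by apply: time_deriv_ext (FdF 1 0) => x; rewrite mxE.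
Qed.

Lemma time_deriv_Psi (G Q Qb : R -> 'M[R]_3) t dG dQ dQb : (G t)^T = G t ->
  mx_time_deriv G t dG -> mx_time_deriv Q t dQ -> mx_time_deriv Qb t dQb ->
  has_time_deriv (fun x => Psi (G x) (Q x) (Qb x)) t
    (2^-1 * inner (dG *m (Q t - Qb t)) (Q t - Qb t) +
     inner (G t *m (Q t - Qb t)) (dQ - dQb)).
Proof.
move=> Gsym GdG QdQ QbdQb; have EdE := mx_time_derivB QdQ QbdQb.
refine (time_deriv_eq (time_derivM (time_deriv_cst (2^-1 : R) t)
  (time_deriv_inner (mx_time_derivM GdG EdE) EdE)) _).
rewrite innerDl [inner (G t *m (dQ - dQb)) _]inner_mulmxl Gsym.
by rewrite [inner (dQ - dQb) _]innerC; field.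
Qed.

End MatrixTimeDeriv.

(** * Rates of the potential and of the axis vector *)

Lemma hatD (R : realType) (x y : 'cV[R]_3) : hat (x + y) = hat x + hat y.
Proof. by apply: matrix3P; elim/ord3P; mx3_expand; ring. Qed.

Lemma hat_tr (R : realType) (x : 'cV[R]_3) : (hat x)^T = - hat x.
Proof. by apply: matrix3P; elim/ord3P; mx3_expand; ring. Qed.

(** The common rate [Om] drops out because a symmetric matrix is orthogonal to a skew one; what
    remains identifies [err_R] as the gradient of the potential in the body frame. *)
Lemma Psi_gradient (R : realType) (G Q Qb : 'M[R]_3) (Om v : 'cV[R]_3) : G^T = G ->
  inner (G *m (Q - Qb)) (Q *m hat Om - Qb *m hat (Om + v)) =
  inner (err_R G Q Qb) v.
Proof.
move=> Gsym; set E := Q - Qb.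
have -> : Q *m hat Om - Qb *m hat (Om + v) = E *m hat Om - Qb *m hat v.
  by rewrite hatD /E mulmxBl mulmxDr opprD addrA.
rewrite innerDr innerNr {1 2}/inner trmx_mul Gsym !mulmxA.
rewrite tr_sym_mul_hat ?sub0r; last by rewrite !trmx_mul trmxK Gsym mulmxA.
rewrite [E^T]raddfB /= !mulmxBl raddfB /= [\tr (Qb^T *m _ *m _ *m _)]tr_sym_mul_hat.
  by rewrite subr0 tr_mul_hat opprK /err_R !trmx_mul trmxK Gsym mulmxA.
by rewrite !trmx_mul trmxK Gsym mulmxA.
Qed.

(** [dS] is the rate of [S = R^T Rbar], so the axis vector [e] has rate
    [e x Om + (tr S) v - S^T v]. *)
Lemma axis_rate_inner (R : realType) (S : 'M[R]_3) (Om v y : 'cV[R]_3)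
    (dS := S *m hat (Om + v) - hat Om *m S) :
  inner (vee (dS - dS^T)) y =
  inner y (cross (vee (S - S^T)) Om) + (\tr S * inner y v - inner y (S^T *m v)).
Proof. by rewrite /dS !inner_cV3; mx3_expand; ring. Qed.

Lemma ler_fnorm_sqr (R : realType) m n (A : 'M[R]_(m, n)) (k b : R) :
  0 <= k -> 0 <= b -> inner A A <= k * b ^+ 2 -> fnorm A <= Num.sqrt k * b.
Proof.
move=> k0 b0 Ab; rewrite -ler_sqr ?nnegrE ?fnorm_ge0 ?mulr_ge0 ?sqrtr_ge0//.
by rewrite fnorm_sqr exprMn sqr_sqrtr.
Qed.

Lemma fnorm_cross_le (R : realType) (x y : 'cV[R]_3) : fnorm (cross x y) <= fnorm x * fnorm y.
Proof.
rewrite -ler_sqr ?nnegrE ?mulr_ge0 ?fnorm_ge0// exprMn !fnorm_sqr cross_sqr.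
by have := sqr_ge0 (inner x y); lra.
Qed.

Lemma fnorm_SO3_mul (R : realType) (S : 'M[R]_3) (x : 'cV[R]_3) : SO3 S ->
  fnorm (S *m x) = fnorm x.
Proof. by move=> [SS _]; rewrite /fnorm inner_mulmxl mulmxA SS mul1mx. Qed.

Lemma fnorm_vec2_sqr (R : realType) (a b : R) : fnorm (vec2 a b) ^+ 2 = a ^+ 2 + b ^+ 2.
Proof.
by rewrite fnorm_sqr inner_sum !big_ord_recl !big_ord0 !mxE /= !addr0 !expr2.
Qed.

Lemma Gmx_sym (R : realType) n (w : 'I_n -> R) s t : (Gmx w s t)^T = Gmx w s t.
Proof.
rewrite /Gmx linear_sum; apply: eq_bigr => i _ /=.
by rewrite linearZ /= trmx_mul trmxK.
Qed.

(** * Error estimates on a sublevel set of the potential *)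

Lemma err_R_bounds (R : realType) (G Q Qb : 'M[R]_3) (a c1 c2 : R)
    (x := fnorm (Q - Qb)) (S := Q^T *m Qb) (e := vee (S - S^T)) (eR := err_R G Q Qb) :
  G^T = G -> SO3 Q -> SO3 Qb -> 0 < c1 -> c1 <= c2 -> a <= 1 / 2 ->
  (forall Q' : 'M[R]_3, SO3 Q' ->
     4^-1 * c1 * fnorm (Q - Q') ^+ 2 <= Psi G Q Q' /\
     Psi G Q Q' <= 4^-1 * c2 * fnorm (Q - Q') ^+ 2) ->
  Psi G Q Qb <= 2 * a * c1 ->
  [/\ 2 * (1 - 2 * a) <= \tr S - 1 <= 2,
      2^-1 * (1 - a) * c1 ^+ 2 * x ^+ 2 <= inner eR eR <= 2^-1 * c2 ^+ 2 * x ^+ 2,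
      inner e eR <= c2 * x ^+ 2 & inner e e <= 2 * x ^+ 2].
Proof.
move=> Gsym hQ hQb c1_gt0 c12 a_le hPsi Psi_le.
have c2_gt0 : 0 < c2 by exact: lt_le_trans c12.
have [QQ _] := hQ.
have hS : SO3 S by apply: SO3_mul => //; exact: SO3_tr.
have QbE : Qb = Q *m S by rewrite /S mulmxA (mulmx1C QQ) mul1mx.
set H := Q^T *m G *m Q.
have Hsym : H^T = H by rewrite /H !trmx_mul trmxK Gsym mulmxA.
have eRE : eR = vee (H *m S - S^T *m H).
  rewrite /eR /err_R; congr vee; congr (_ - _).
    by rewrite {1}QbE /H -!mulmxA.
  by rewrite {1}QbE trmx_mul /H !mulmxA.
have form (y : 'cV[R]_3) : 0 <= inner y (((\tr H)%:M - H) *m y) <= c2 * inner y y.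
  have /andP[lo ->] := Psi_bounds_form Gsym hQ hPsi y.
  by rewrite andbT; apply: le_trans lo; rewrite mulr_ge0 ?inner_ge0// ltW.
have xE : x ^+ 2 = 2 * (3 - \tr S) by rewrite /x QbE dist_relative.
have := hPsi _ hQb; rewrite -/x => -[Psi_lo Psi_up].
have PsiE : Psi G Q Qb = \tr H - \tr (H *m S) by rewrite {1}QbE Psi_relative.
have x2_ge0 := sqr_ge0 x.
rewrite xE in Psi_lo Psi_up x2_ge0 *.
(* From [c1 (3 - \tr S) / 2 <= Psi <= 2 a c1]; in particular half turns are excluded. *)
have tr_ge : 2 * (1 - 2 * a) <= \tr S - 1.
  by rewrite -(ler_pM2l c1_gt0); move: Psi_lo Psi_le; lra.
have tr_le : \tr S - 1 <= 2 by lra.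
have tr_gt : 0 < \tr S + 1 by lra.
have lower := err_lower hS Hsym tr_gt.
have upper := err_upper hS Hsym c2_gt0 form tr_gt.
have axis := err_axis_inner hS Hsym tr_gt.
rewrite -PsiE -eRE in lower upper axis.
split.
- by rewrite tr_ge.
- apply/andP; split; last by move: upper; lra.
  (* The lower bound is divided by [3 - \tr S], which vanishes exactly at zero attitude error. *)
  have [->|tr3] := eqVneq (\tr S) 3.
    by rewrite subrr !mulr0 inner_ge0.
  have dtr : 0 < 3 - \tr S by rewrite lt_neqAle eq_sym subr_eq0 eq_sym tr3 /=; lra.
  rewrite -(ler_pM2r dtr); apply: le_trans lower.
  have Psi2 : (4^-1 * c1 * (2 * (3 - \tr S))) ^+ 2 <= Psi G Q Qb ^+ 2.
    rewrite ler_sqr ?nnegrE//; first by rewrite !mulr_ge0//; lra.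
    by apply: le_trans Psi_lo; rewrite !mulr_ge0//; lra.
  have tr_a : 4 * (1 - a) <= \tr S + 1 by lra.
  apply: le_trans (ler_wpM2l (ltW tr_gt) Psi2).
  have sq_ge0 : 0 <= (c1 * (3 - \tr S)) ^+ 2 by exact: sqr_ge0.
  by have := ler_wpM2r sq_ge0 tr_a; lra.
- have Psi_ge0 : 0 <= Psi G Q Qb by apply: le_trans Psi_lo; rewrite !mulr_ge0//; lra.
  rewrite axis; apply: (@le_trans _ _ (4 * Psi G Q Qb)); last by move: Psi_up; lra.
  by rewrite ler_wpM2r//; lra.
- rewrite (SO3_axis_sqr hS) mulrA ler_wpM2r//; lra.
Qed.

(** * Gain conditions and positivity of the comparison matrices *)

(** At [a = 1 / 2] this is the assumption on [kR], and a smaller [a] only increases the left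
    term. *)
Lemma gain_gt0 (R : realType) (a d c1 kR : R) : 0 < c1 -> 0 < kR ->
  2 * d / c1 ^+ 2 < kR -> a <= 1 / 2 -> 0 < (1 - a) * c1 ^+ 2 * kR - d.
Proof.
move=> c1_gt0 kR_gt0; rewrite ltr_pdivrMr ?exprn_gt0// mulrC -mulrA [kR * _]mulrC.
have : 0 < c1 ^+ 2 * kR by rewrite mulr_gt0 ?exprn_gt0.
move: (c1 ^+ 2 * kR) => p p_gt0 p_gt a_le.
have : 0 <= (1 / 2 - a) * p by rewrite mulr_ge0 ?subr_ge0// ltW.
by move: p_gt; lra.
Qed.

Section Gains.
Variables (R : realType) (a d c1 c2 B kR kg mu : R).
Hypotheses (c1_gt0 : 0 < c1) (c12 : c1 <= c2).
Hypotheses (kR_gt0 : 0 < kR) (kg_gt0 : 0 < kg).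
Hypotheses (a_lt : a < 1 / 2) (gain_gt0 : 0 < (1 - a) * c1 ^+ 2 * kR - d).

Let c2_gt0 : 0 < c2. Proof. exact: lt_le_trans c12. Qed.

Lemma mu_bound_gt0 : 0 < mu_bound a d c1 c2 B kR kg.
Proof.
rewrite /mu_bound !lt_min; apply/and3P; split.
- by rewrite sqrtr_gt0 divr_gt0// mulr_gt0.
- by rewrite divr_gt0// !mulr_gt0.
- have a2 : 0 < 1 - 2 * a by move: a_lt; lra.
  by rewrite divr_gt0 ?mulr_gt0 ?invr_gt0// ltr_wpDl ?sqr_ge0// !mulr_gt0.
Qed.

Hypotheses (mu_gt0 : 0 < mu) (mu_lt : mu < mu_bound a d c1 c2 B kR kg).

(** The first bound on [mu] says that [M1] has positive determinant; [c1 <= c2] carries this over to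
    [M2]. *)
Let mu_sqr_lt : (Num.sqrt 2 / 2 * mu) ^+ 2 < 4^-1 * c1 * (2 * kg)^-1.
Proof.
have := mu_lt; rewrite /mu_bound !lt_min => /and3P[mu1 _ _].
have : mu ^+ 2 < c1 / (4 * kg).
  rewrite -[ltRHS]sqr_sqrtr; last by rewrite divr_ge0// ltW// mulr_gt0.
  by rewrite ltr_sqr ?nnegrE ?sqrtr_ge0// ltW.
have -> : 4^-1 * c1 * (2 * kg)^-1 = 2^-1 * (c1 / (4 * kg)).
  by field; rewrite gt_eqF.
have -> : (Num.sqrt 2 / 2 * mu) ^+ 2 = 2^-1 * mu ^+ 2.
  by rewrite exprMn expr_div_n sqr_sqrtr//; field.
by rewrite ltr_pM2l.
Qed.

Lemma lambda_M1_gt0 : 0 < lambda_min (M1 c1 kg mu).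
Proof.
by apply: (lambda_mx22_gt0 _ _).1; rewrite ?mulr_gt0// sqrrN.
Qed.

Lemma lambda_M2_gt0 : 0 < lambda_max (M2 c2 kg mu).
Proof.
apply: (lambda_mx22_gt0 _ _).2; rewrite ?mulr_gt0//.
apply: lt_le_trans mu_sqr_lt _; rewrite ler_pM2r ?invr_gt0 ?mulr_gt0//.
by rewrite ler_pM2l.
Qed.

(** The second bound on [mu] makes the upper left entry positive; the third, multiplied by [2 * mu],
    makes the determinant positive. *)
Lemma lambda_M3_gt0 : 0 < lambda_min (M3 a d c1 c2 B kR kg mu).
Proof.
have := mu_lt; rewrite /mu_bound !lt_min => /and3P[_ mu2 mu3].
have a2 : 0 < 1 - 2 * a by move: a_lt; lra.
rewrite ltr_pdivlMr ?mulr_gt0// in mu2.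
rewrite ltr_pdivlMr in mu3; last by rewrite ltr_wpDl ?sqr_ge0// !mulr_gt0.
apply: (lambda_mx22_gt0 _ _).1; first by move: mu2; lra.
rewrite sqrrN; set D := c2 * kR + B / 2 in mu3 *.
have -> : (mu * Num.sqrt 2 * D) ^+ 2 = 2 * mu * (mu * D ^+ 2).
  by rewrite !exprMn sqr_sqrtr//; ring.
rewrite -subr_gt0 in mu3; rewrite -subr_gt0.
have := mulr_gt0 (mulr_gt0 (ltr0Sn R 1) mu_gt0) mu3.
by congr (0 < _); ring.
Qed.

End Gains.

(** * Energy and Lyapunov function along a trajectory *)

Section Trajectory.
Variables (R : realType) (G Rt dG Rb : R -> 'M[R]_3) (Omega gb : R -> 'cV[R]_3).
Variables (gamma : 'cV[R]_3) (B d c1 c2 kR kg : R).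
Hypothesis Gsym : forall t, (G t)^T = G t.
Hypothesis GdG : forall t, 0 <= t -> has_time_deriv G t (dG t).
Hypothesis dG_le : forall t, 0 <= t -> fnorm (dG t) <= d.
Hypothesis kinematics : attitude_kinematics Rt Omega.
Hypothesis Omega_le : forall t, 0 <= t -> fnorm (Omega t) <= B.
Hypothesis c1_gt0 : 0 < c1.
Hypothesis c12 : c1 <= c2.
Hypothesis Psi_bounds : forall (Q : 'M[R]_3) t, SO3 Q -> 0 <= t ->
  4^-1 * c1 * fnorm (Rt t - Q) ^+ 2 <= Psi (G t) (Rt t) Q /\
  Psi (G t) (Rt t) Q <= 4^-1 * c2 * fnorm (Rt t - Q) ^+ 2.
Hypothesis kR_gt0 : 0 < kR.
Hypothesis kg_gt0 : 0 < kg.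
Hypothesis kR_large : 2 * d / c1 ^+ 2 < kR.
Hypothesis observer :
  observer_solution kR kg G Rt (fun t => Omega t + gamma) Rb gb.

Let x t := fnorm (Rt t - Rb t).
Let y t := fnorm (gamma - gb t).
Let eg t := gamma - gb t.
Let eR t := err_R (G t) (Rt t) (Rb t).
Let S t := (Rt t)^T *m Rb t.
Let e t := vee (S t - (S t)^T).
(** The body rate of the estimate is [Omega + v]. *)
Let v t := eg t - kR *: eR t.
Let psi t := Psi (G t) (Rt t) (Rb t).

Definition energy t := psi t + (2 * kg)^-1 * y t ^+ 2.

Let energy_rate t :=
  2^-1 * inner (dG t *m (Rt t - Rb t)) (Rt t - Rb t) - kR * inner (eR t) (eR t).

Lemma mx_deriv_Rt t : 0 <= t -> mx_time_deriv Rt t (Rt t *m hat (Omega t)).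
Proof. by move=> /kinematics[_]; exact: time_deriv_mx. Qed.

Lemma mx_deriv_Rb t : 0 <= t -> mx_time_deriv Rb t (Rb t *m hat (Omega t + v t)).
Proof.
move=> /observer[_ + _] => /time_deriv_mx.
by rewrite (_ : Omega t + gamma - gb t - _ = Omega t + v t)// /v /eg !addrA.
Qed.

Lemma mx_deriv_eg t : 0 <= t -> mx_time_deriv eg t (- (kg *: eR t)).
Proof.
move=> /observer[_ _ /time_deriv_mx gd]; rewrite -sub0r.
by apply: mx_time_derivB => //; exact: mx_time_deriv_cst.
Qed.

(** The bias update makes the rate of the bias energy [- eR . eg], cancelling the indefinite term in
    the rate of the potential. *)
Lemma energy_deriv t : 0 <= t -> has_time_deriv energy t (energy_rate t).
Proof.
move=> t0; have egd := mx_deriv_eg t0.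
apply: (@time_deriv_ext _ _ (fun s => psi s + (2 * kg)^-1 * inner (eg s) (eg s))).
  by move=> s; rewrite /energy /y fnorm_sqr.
refine (time_deriv_eq (time_derivD (time_deriv_Psi (Gsym t) (time_deriv_mx (GdG t0))
  (mx_deriv_Rt t0) (mx_deriv_Rb t0))
  (time_derivM (time_deriv_cst ((2 * kg)^-1 : R) t) (time_deriv_inner egd egd))) _).
have -> : inner (- (kg *: eR t)) (eg t) + inner (eg t) (- (kg *: eR t)) =
    - 2 * kg * inner (eR t) (eg t).
  by rewrite innerNl innerZl innerNr innerZr (innerC (eg t)); ring.
rewrite Psi_gradient// -/(eR t).
have -> : inner (eR t) (v t) = inner (eR t) (eg t) - kR * inner (eR t) (eR t).
  by rewrite /v innerDr innerNr innerZr.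
rewrite /energy_rate; field.
by rewrite gt_eqF.
Qed.

Let psi_le_energy t : psi t <= energy t.
Proof. by rewrite lerDl mulr_ge0 ?sqr_ge0// invr_ge0 ltW// mulr_gt0. Qed.

Let bounds a t : 0 <= t -> a <= 1 / 2 -> psi t <= 2 * a * c1 ->
  [/\ 2 * (1 - 2 * a) <= \tr (S t) - 1 <= 2,
      2^-1 * (1 - a) * c1 ^+ 2 * x t ^+ 2 <= inner (eR t) (eR t)
        <= 2^-1 * c2 ^+ 2 * x t ^+ 2,
      inner (e t) (eR t) <= c2 * x t ^+ 2 & inner (e t) (e t) <= 2 * x t ^+ 2].
Proof.
move=> t0 a2 psi_le; have [hR _] := kinematics t0; have [hRb _ _] := observer t0.
by apply: err_R_bounds => // Q hQ; exact: Psi_bounds.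
Qed.

Let energy_rate_le a t : 0 <= t -> a <= 1 / 2 -> psi t <= 2 * a * c1 ->
  energy_rate t <= - (2^-1 * ((1 - a) * c1 ^+ 2 * kR - d)) * x t ^+ 2.
Proof.
move=> t0 a2 /(bounds t0 a2)[_ /andP[lo _] _ _].
have dGE : inner (dG t *m (Rt t - Rb t)) (Rt t - Rb t) <= d * x t ^+ 2.
  apply: le_trans (ler_norm _) _; apply: le_trans (ler_inner_fnorm _ _) _.
  rewrite -/(x t) expr2 mulrA ler_wpM2r ?fnorm_ge0//.
  apply: le_trans (fnorm_mulmx _ _) _.
  by rewrite ler_wpM2r ?fnorm_ge0// dG_le.
rewrite /energy_rate; have := ler_wpM2l (ltW kR_gt0) lo.
by move: dGE; lra.
Qed.

Lemma energy_nincr t : energy 0 < c1 -> 0 <= t -> energy t <= energy 0.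
Proof.
move=> E0; apply: (@time_deriv_barrier _ _ energy_rate c1) => // {}t t0.
  exact: energy_deriv.
(* Taking [a = 1 / 2] makes the level [2 a c1] equal to the barrier level [c1], and the gain is
   still positive there. *)
move=> Et; have half : 1 / 2 <= 1 / 2 :> R by [].
apply: (le_trans (energy_rate_le t0 half _)).
  by have := psi_le_energy t; lra.
by rewrite mulNr oppr_le0 mulr_ge0 ?sqr_ge0// mulr_ge0// ltW// gain_gt0.
Qed.

Section Rate.
Variables (a mu : R).
Hypotheses (a_lt : a < 1 / 2) (mu_gt0 : 0 < mu).
Hypothesis energy0 : energy 0 <= 2 * a * c1.

(** The energy rate bound has no damping in [eg]; the cross term supplies it, because the rate of
    [e] contains [eg] through [v]. *)
Definition lyap t := energy t - mu * inner (e t) (eg t).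

Let psi_le t : 0 <= t -> psi t <= 2 * a * c1.
Proof.
move=> t0; apply: le_trans energy0; apply: le_trans (psi_le_energy t) _.
apply: energy_nincr => //; apply: le_lt_trans energy0 _.
by rewrite -[ltRHS]mul1r ltr_pM2r//; move: a_lt; lra.
Qed.

Let lyap_rate t :=
  energy_rate t - mu * (inner (eg t) (cross (e t) (Omega t)) +
    (\tr (S t) * inner (eg t) (v t) - inner (eg t) ((S t)^T *m v t)) -
    kg * inner (e t) (eR t)).

Lemma lyap_deriv t : 0 <= t -> has_time_deriv lyap t (lyap_rate t).
Proof.
move=> t0; have Sd := mx_time_derivM (mx_time_deriv_tr (mx_deriv_Rt t0)) (mx_deriv_Rb t0).
have ed := mx_time_deriv_vee (mx_time_derivB Sd (mx_time_deriv_tr Sd)).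
have eegd := time_deriv_inner ed (mx_deriv_eg t0).
apply: (@time_deriv_ext _ _ (fun s => energy s + (- mu) * inner (e s) (eg s))).
  by move=> s; rewrite mulNr.
refine (time_deriv_eq (time_derivD (energy_deriv t0)
  (time_derivM (time_deriv_cst (- mu : R) t) eegd)) _).
(* The common rate acts on both sides of [S], which is the form of [dS] in [axis_rate_inner]. *)
have -> : (Rt t *m hat (Omega t))^T *m Rb t + (Rt t)^T *m (Rb t *m hat (Omega t + v t))
    = S t *m hat (Omega t + v t) - hat (Omega t) *m S t.
  by rewrite trmx_mul hat_tr mulNmx mulmxA mulNmx -!mulmxA addrC.
rewrite axis_rate_inner innerNr innerZr -/(e t) /lyap_rate; ring.
Qed.

Let fnorm_e t : 0 <= t -> fnorm (e t) <= Num.sqrt 2 * x t.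
Proof.
move=> t0; have [_ _ _ ee] := bounds t0 (ltW a_lt) (psi_le t0).
by apply: ler_fnorm_sqr; rewrite ?fnorm_ge0.
Qed.

Let cross_term t : 0 <= t -> `|inner (e t) (eg t)| <= Num.sqrt 2 * (x t * y t).
Proof.
move=> t0; apply: le_trans (ler_inner_fnorm _ _) _; rewrite mulrA.
by rewrite ler_wpM2r ?fnorm_ge0// fnorm_e.
Qed.

Let psi_bounds t : 0 <= t ->
  4^-1 * c1 * x t ^+ 2 <= psi t /\ psi t <= 4^-1 * c2 * x t ^+ 2.
Proof. by move=> t0; have [hRb _ _] := observer t0; exact: Psi_bounds. Qed.

Lemma lyap_ge t : 0 <= t ->
  lambda_min (M1 c1 kg mu) * (x t ^+ 2 + y t ^+ 2) <= lyap t.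
Proof.
move=> t0; have [M1_le _] := lambda_mx22_bounds (4^-1 * c1) (- (Num.sqrt 2 / 2 * mu))
  ((2 * kg)^-1) (x t) (y t).
apply: le_trans M1_le _; rewrite /lyap /energy.
have [lo _] := psi_bounds t0.
have := ler_wpM2l (ltW mu_gt0) (le_trans (ler_norm _) (cross_term t0)).
by move: lo; lra.
Qed.

Lemma lyap_le t : 0 <= t ->
  lyap t <= lambda_max (M2 c2 kg mu) * (x t ^+ 2 + y t ^+ 2).
Proof.
move=> t0; have [_ M2_ge] := lambda_mx22_bounds (4^-1 * c2) (Num.sqrt 2 / 2 * mu)
  ((2 * kg)^-1) (x t) (y t).
apply: le_trans M2_ge; rewrite /lyap /energy.
have [_ up] := psi_bounds t0.
have := cross_term t0; rewrite ler_norml => /andP[/(ler_wpM2l (ltW mu_gt0)) lo _].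
by move: up lo; lra.
Qed.

(** Writing [x = |E_R|] and [y = |eg|], the mixed terms are [sqrt 2 B x y] from the gyro rate and
    [2 sqrt 2 kR c2 x y] from the feedback; together they form the off-diagonal of [M3]. *)
Lemma lyap_rate_le t : 0 <= t ->
  lyap_rate t <= - (lambda_min (M3 a d c1 c2 B kR kg mu) * (x t ^+ 2 + y t ^+ 2)).
Proof.
move=> t0; have a2 := ltW a_lt.
have [M3_le _] := lambda_mx22_bounds
  (2^-1 * ((1 - a) * c1 ^+ 2 * kR - d) - mu * c2 * kg)
  (- (mu * Num.sqrt 2 * (c2 * kR + B / 2))) (2 * mu * (1 - 2 * a)) (x t) (y t).
rewrite lerNr; apply: le_trans M3_le _; rewrite lerNr /lyap_rate.
have [/andP[tr_ge tr_le] /andP[_ eR_up] eeR _] := bounds t0 a2 (psi_le t0).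
have E_le := energy_rate_le t0 a2 (psi_le t0).
have [hR _] := kinematics t0; have [hRb _ _] := observer t0.
have hST : SO3 (S t)^T by apply/SO3_tr/SO3_mul => //; exact: SO3_tr.
have x_ge0 : 0 <= x t by exact: fnorm_ge0.
have y_ge0 : 0 <= y t by exact: fnorm_ge0.
have c2_ge0 : 0 <= c2 by apply: le_trans c12; exact: ltW.
have r_le : fnorm (eR t) <= Num.sqrt 2 / 2 * c2 * x t.
  have s2 : Num.sqrt 2 ^+ 2 = 2 :> R by rewrite sqr_sqrtr.
  rewrite -ler_sqr ?nnegrE ?fnorm_ge0 ?mulr_ge0 ?sqrtr_ge0// fnorm_sqr.
  apply: le_trans eR_up _; rewrite !exprMn s2 le_eqVlt.
  by apply/orP; left; apply/eqP; field.
have yr_le : y t * fnorm (eR t) <= Num.sqrt 2 / 2 * c2 * (x t * y t).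
  rewrite (_ : Num.sqrt 2 / 2 * c2 * (x t * y t) = y t * (Num.sqrt 2 / 2 * c2 * x t)).
    by rewrite ler_wpM2l.
  by ring.
have gyro : - (Num.sqrt 2 * B * (x t * y t)) <= inner (eg t) (cross (e t) (Omega t)).
  have : `|inner (eg t) (cross (e t) (Omega t))| <= Num.sqrt 2 * B * (x t * y t).
    apply: le_trans (ler_inner_fnorm _ _) _; rewrite -/(y t).
    rewrite (_ : Num.sqrt 2 * B * (x t * y t) = y t * (Num.sqrt 2 * x t * B)); last by ring.
    rewrite ler_wpM2l//; apply: le_trans (fnorm_cross_le _ _) _.
    by rewrite ler_pM ?fnorm_ge0 ?fnorm_e ?Omega_le.
  by rewrite ler_norml => /andP[].
have vE : \tr (S t) * inner (eg t) (v t) - inner (eg t) ((S t)^T *m v t) =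
    (\tr (S t) * y t ^+ 2 - inner (eg t) ((S t)^T *m eg t)) -
    kR * (\tr (S t) * inner (eg t) (eR t) - inner (eg t) ((S t)^T *m eR t)).
  have gen (M : 'M[R]_3) (k tau : R) (p q : 'cV[R]_3) :
      tau * inner p (p - k *: q) - inner p (M *m (p - k *: q)) =
      tau * inner p p - inner p (M *m p) - k * (tau * inner p q - inner p (M *m q)).
    by rewrite mulmxBr -scalemxAr !innerDr !innerNr !innerZr; ring.
  by rewrite /v gen /y fnorm_sqr.
have p_le : inner (eg t) ((S t)^T *m eg t) <= y t ^+ 2.
  apply: le_trans (ler_norm _) _; apply: le_trans (ler_inner_fnorm _ _) _.
  by rewrite fnorm_SO3_mul.
have i1_le : inner (eg t) (eR t) <= y t * fnorm (eR t).
  by apply: le_trans (ler_norm _) _; exact: ler_inner_fnorm.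
have i2_le : - inner (eg t) ((S t)^T *m eR t) <= y t * fnorm (eR t).
  rewrite -(fnorm_SO3_mul (eR t) hST).
  apply: le_trans (ler_inner_fnorm _ _); apply: le_trans (ler_norm _) _.
  by rewrite normrN.
have tr_ge0 : 0 <= \tr (S t) by lra.
have tr_le3 : \tr (S t) <= 3 by lra.
have yr_ge0 : 0 <= y t * fnorm (eR t) by rewrite mulr_ge0 ?fnorm_ge0.
have tri1 : \tr (S t) * inner (eg t) (eR t) <= 3 * (y t * fnorm (eR t)).
  apply: (le_trans (ler_wpM2l tr_ge0 i1_le)); exact: ler_wpM2r.
(* The extra 1 absorbs the term [eg . S^T eg], leaving [2 (1 - 2 a) y^2]. *)
have try : (2 * (1 - 2 * a) + 1) * y t ^+ 2 <= \tr (S t) * y t ^+ 2.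
  by rewrite ler_wpM2r ?sqr_ge0//; lra.
rewrite vE.
(* The trace is at most 3 and [S^T] is an isometry, so the feedback costs at most [4 kR y |eR|],
   with [|eR| <= c2 x / sqrt 2]. *)
have damp : 2 * (1 - 2 * a) * y t ^+ 2 - kR * (2 * Num.sqrt 2 * c2 * (x t * y t)) <=
    (\tr (S t) * y t ^+ 2 - inner (eg t) ((S t)^T *m eg t)) -
    kR * (\tr (S t) * inner (eg t) (eR t) - inner (eg t) ((S t)^T *m eR t)).
  apply: lerB; first by move: try p_le; lra.
  by rewrite ler_wpM2l ?(ltW kR_gt0)//; move: tri1 i2_le yr_le; lra.
have kgc := ler_wpM2l (ltW kg_gt0) eeR.
have tot := ler_wpM2l (ltW mu_gt0) (lerB (lerD gyro damp) kgc).
by move: E_le tot; lra.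
Qed.

Let l1 := lambda_min (M1 c1 kg mu).
Let l2 := lambda_max (M2 c2 kg mu).
Let l3 := lambda_min (M3 a d c1 c2 B kR kg mu).
Hypotheses (l1_gt0 : 0 < l1) (l2_gt0 : 0 < l2) (l3_gt0 : 0 < l3).

(** The bounds through [l3] and [l2] make [lyap] decay at rate [l3 / l2]; the bounds by [l1] and
    [l2] transfer this to the squared error, and the square root halves the rate. *)
Lemma error_decay t : 0 <= t ->
  fnorm (est_error Rt gamma Rb gb t) <=
  Num.sqrt (l2 / l1) * fnorm (est_error Rt gamma Rb gb 0) *
    expR (- (l3 / l2 / 2) * t).
Proof.
move=> t0.
have rate s : 0 <= s -> lyap_rate s <= - (l3 / l2) * lyap s.
  move=> s0; apply: le_trans (lyap_rate_le s0) _.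
  rewrite mulNr lerN2 -/l3 -mulrA ler_pM2l// mulrC ler_pdivrMr// mulrC.
  exact: lyap_le.
have decay := time_deriv_gronwall lyap_deriv rate t0.
rewrite -ler_sqr ?nnegrE ?mulr_ge0 ?fnorm_ge0 ?sqrtr_ge0 ?expR_ge0//.
have l21 : Num.sqrt (l2 / l1) ^+ 2 = l2 / l1.
  by rewrite sqr_sqrtr// ltW// divr_gt0.
rewrite !exprMn !fnorm_vec2_sqr l21.
rewrite -expRM_natl (_ : 2%:R * (- (l3 / l2 / 2) * t) = - (l3 / l2) * t); last first.
  by field; rewrite gt_eqF.
rewrite -/(x t) -/(y t) -/(x 0) -/(y 0).
rewrite -(ler_pM2l l1_gt0).
apply: le_trans (lyap_ge t0) _; apply: le_trans decay _.
have -> : l1 * (l2 / l1 * (x 0 ^+ 2 + y 0 ^+ 2) * expR (- (l3 / l2) * t)) =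
  l2 * (x 0 ^+ 2 + y 0 ^+ 2) * expR (- (l3 / l2) * t) by field; rewrite gt_eqF.
by rewrite ler_wpM2r ?expR_ge0// lyap_le.
Qed.

End Rate.
End Trajectory.

(** * Exponential convergence and local stability of the observer *)

Theorem theorem1 (R : realType) (n : nat)
  (w : 'I_n -> R) (hw : forall i, 0 < w i)
  (s : 'I_n -> R -> 'cV[R]_3)
  (hs : forall i t, 0 <= t -> sphere2 (s i t))
  (Rt : R -> 'M[R]_3) (Omega : R -> 'cV[R]_3) (gamma : 'cV[R]_3)
  (hR : attitude_kinematics Rt Omega)
  (BOmega c d : R) (hB : 0 < BOmega) (hc : 0 < c) (hd : 0 < d)
  (hOmega : forall t, 0 <= t -> fnorm (Omega t) <= BOmega)
  (hlambda2 : forall t, 0 <= t -> c <= lambda_2 (Gmx w s t))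
  (dG : R -> 'M[R]_3)
  (hdG : forall t, 0 <= t -> has_time_deriv (Gmx w s) t (dG t))
  (hdG_bound : forall t, 0 <= t -> fnorm (dG t) <= d)
  (c1 c2 : R) (hc1 : 0 < c1) (hc12 : c1 <= c2)
  (hPsi : forall (Q : 'M[R]_3) (t : R), SO3 Q -> 0 <= t ->
     4^-1 * c1 * fnorm (Rt t - Q) ^+ 2 <= Psi (Gmx w s t) (Rt t) Q /\
     Psi (Gmx w s t) (Rt t) Q <= 4^-1 * c2 * fnorm (Rt t - Q) ^+ 2)
  (kR kg : R) (hkR : 0 < kR) (hkg : 0 < kg)
  (hkR_large : 2 * d / c1 ^+ 2 < kR) :
  locally_exp_stable kR kg (Gmx w s) Rt Omega gamma /\
  (forall a mu : R, 0 < a -> a < 1 / 2 ->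
     0 < mu -> mu < mu_bound a d c1 c2 BOmega kR kg ->
     let beta := Num.sqrt (lambda_max (M2 c2 kg mu) / lambda_min (M1 c1 kg mu)) in
     let sigma := lambda_min (M3 a d c1 c2 BOmega kR kg mu) /
                  lambda_max (M2 c2 kg mu) in
     forall (Rbar : R -> 'M[R]_3) (gbar : R -> 'cV[R]_3),
       observer_solution kR kg (Gmx w s) Rt (fun t => Omega t + gamma) Rbar gbar ->
       let z := est_error Rt gamma Rbar gbar in
       Psi (Gmx w s 0) (Rt 0) (Rbar 0) +
         (2 * kg)^-1 * fnorm (gamma - gbar 0) ^+ 2 <= 2 * a * c1 ->
       forall t, 0 <= t ->
         fnorm (z t) <= beta * fnorm (z 0) * expR (- (sigma / 2) * t)).
Proof.
have c2_gt0 : 0 < c2 by exact: lt_le_trans hc12.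
have decay a mu : 0 < a -> a < 1 / 2 -> 0 < mu ->
    mu < mu_bound a d c1 c2 BOmega kR kg ->
    let l1 := lambda_min (M1 c1 kg mu) in let l2 := lambda_max (M2 c2 kg mu) in
    let l3 := lambda_min (M3 a d c1 c2 BOmega kR kg mu) in
    [/\ 0 < l1, 0 < l2, 0 < l3 &
      forall (Rbar : R -> 'M[R]_3) (gbar : R -> 'cV[R]_3),
      observer_solution kR kg (Gmx w s) Rt (fun t => Omega t + gamma) Rbar gbar ->
      Psi (Gmx w s 0) (Rt 0) (Rbar 0) +
        (2 * kg)^-1 * fnorm (gamma - gbar 0) ^+ 2 <= 2 * a * c1 ->
      forall t, 0 <= t ->
        fnorm (est_error Rt gamma Rbar gbar t) <=
        Num.sqrt (l2 / l1) * fnorm (est_error Rt gamma Rbar gbar 0) *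
          expR (- (l3 / l2 / 2) * t)].
  move=> a_gt0 a_lt mu_gt0 mu_lt l1 l2 l3.
  have gain := gain_gt0 hc1 hkR hkR_large (ltW a_lt).
  have l1_gt0 : 0 < l1 by exact: lambda_M1_gt0 mu_lt.
  have l2_gt0 : 0 < l2 by exact: lambda_M2_gt0 mu_lt.
  have l3_gt0 : 0 < l3 by exact: lambda_M3_gt0 mu_lt.
  split=> // Rbar gbar obs E0 t t0.
  apply: (error_decay (Gmx_sym w s) hdG hdG_bound hR hOmega hc1 hc12 hPsi) => //.
split; last first.
  move=> a mu a_gt0 a_lt mu_gt0 mu_lt beta sigma Rbar gbar obs z E0 t t0.
  by have [_ _ _] := decay a mu a_gt0 a_lt mu_gt0 mu_lt; exact.
(* For local stability any admissible pair serves: a point inside [(0, 1 / 2)] and half of the bound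
   on [mu]. *)
pose a : R := 1 / 4; pose mu := mu_bound a d c1 c2 BOmega kR kg / 2.
have a_gt0 : 0 < a by rewrite /a; lra.
have a_lt : a < 1 / 2 by rewrite /a; lra.
have bound_gt0 : 0 < mu_bound a d c1 c2 BOmega kR kg.
  exact: mu_bound_gt0 (gain_gt0 hc1 hkR hkR_large (ltW a_lt)).
have [||l1_gt0 l2_gt0 l3_gt0 dec] := decay a mu a_gt0 a_lt.
- by rewrite /mu divr_gt0.
- by rewrite /mu ltr_pdivrMr// ltr_pMr// ltr1n.
have kg2_gt0 : 0 < (2 * kg)^-1 by rewrite invr_gt0 mulr_gt0.
(* The initial energy is at most [C |z 0|^2], so the radius [sqrt (2 a c1 / C)] keeps the start
   inside the required sublevel set. *)
pose C := 4^-1 * c2 + (2 * kg)^-1.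
have C_gt0 : 0 < C by rewrite addr_gt0// mulr_gt0.
exists (Num.sqrt (2 * a * c1 / C)), (Num.sqrt (lambda_max (M2 c2 kg mu) /
  lambda_min (M1 c1 kg mu))), (lambda_min (M3 a d c1 c2 BOmega kR kg mu) /
  lambda_max (M2 c2 kg mu) / 2); split.
- by rewrite sqrtr_gt0 divr_gt0// !mulr_gt0.
- by rewrite sqrtr_gt0 divr_gt0.
- by rewrite !divr_gt0.
move=> Rbar gbar obs z z0_lt; apply: dec => //.
have [hRb _ _] := obs 0 (lexx 0).
have [_ Psi_up] := hPsi _ 0 hRb (lexx 0).
have : fnorm (z 0) ^+ 2 < 2 * a * c1 / C.
  rewrite -[ltRHS]sqr_sqrtr; last by rewrite divr_ge0// ltW// !mulr_gt0.
  by rewrite ltr_sqr ?nnegrE ?fnorm_ge0 ?sqrtr_ge0.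
rewrite /z /est_error fnorm_vec2_sqr ltr_pdivlMr// => zC.
apply: le_trans (ltW zC); apply: (le_trans (lerD Psi_up (lexx _))).
have := mulr_ge0 (ltW kg2_gt0) (sqr_ge0 (fnorm (Rt 0 - Rbar 0))).
have : 0 <= 4^-1 * c2 * fnorm (gamma - gbar 0) ^+ 2.
  by rewrite mulr_ge0 ?sqr_ge0// mulr_ge0// ltW.
by rewrite /C; lra.
Qed.
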